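(* Let $\mathfrak{p}=(\theta-t_0,\eta-y_0)\subseteq A$ be the prime ideal attached to a point $P=(t_0,y_0)\in E(\mathbb{F}_q)\setminus\{\infty\}$. Let $S_i=\sum_{a\in A_{i+}}1/a$ and $S_{\mathfrak{p},i}=\sum_{a\in\mathfrak{p}_{i+}}1/a$. Then: (a) for $i\ge2$, $\displaystyle S_i=\frac{\nu^{(i)}}{g_i^{(1)}\cdot f^{(1)}\cdots f^{(i)}}\bigg|_{\Xi}$; (b) for $i\ge2$, $\displaystyle S_{\mathfrak{p},i}=\frac{\nu^{(i-1)}}{g_{\mathfrak{p},i}^{(1)}\cdot f^{(1)}\cdots f^{(i-1)}}\bigg|_{\Xi}$.
   Context: Let $q$ be a power of a prime and $E/\mathbb{F}_q$ the elliptic curve $y^2+a_1ty+a_3y=t^3+a_2t^2+a_4t+a_6$ with point $\infty$. Let $\theta,\eta$ satisfy the same equation, $A=\mathbb{F}_q[\theta,\eta]$, $K=\mathbb{F}_q(\theta,\eta)$. Let $\deg=-\mathrm{ord}_\infty$ ($\deg\theta=2,\deg\eta=3$), $K_\infty$ the completion at $\infty$ with maximal ideal $\mathfrak{M}_\infty$. The sign of nonzero $a\in A$ is its leading coefficient with respect to the basis $\{\theta^i,\theta^j\eta\}$; $A_{i+}$ (resp. $\mathfrak{p}_{i+}$) is the set of elements of $A$ (resp. $\mathfrak{p}$) of degree $i$ and sign $1$. For nonzero $g\in L[t,y]$, $\widetilde{\mathrm{sgn}}(g)$ is its leading coefficient with respect to the monomials $t^i,t^jy$, extended multiplicatively. Twisting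 $g\mapsto g^{(k)}$ raises coefficients to the $q^k$-th power; $X^{(k)}$ is the $q^k$-Frobenius image of a point; ''$|_\Xi$'' means evaluation at $\Xi=(\theta,\eta)$. Let $V=(\alpha,\beta)$ be the unique point of the formal group $\widehat{E}(\mathfrak{M}_\infty)$ with $V-V^{(1)}=\Xi$, $H=K(\alpha,\beta)$, $m=(\eta-\beta^q)/(\theta-\alpha^q)$, $\nu=y-\eta-m(t-\theta)$, $f=\nu/(t-\alpha)$. For $i\ge2$ let $g_i\in H[t,y]$ be the function with $\widetilde{\mathrm{sgn}}(g_i)=1$ and divisor $(V^{(i-1)}-V)+(-V^{(i-1)})+(V)-3(\infty)$ (differences of points taken in the group law), explicitly $g_i=y-\beta+\frac{\beta^{q^{i-1}}+a_1\alpha^{q^{i-1}}+a_3+\beta}{\alpha^{q^{i-1}}-\alpha}(t-\alpha)$; and let $g_{\mathfrak{p},i}$ be the function with $\widetilde{\mathrm{sgn}}(g_{\mathfrak{p},i})=1$ and divisor $(V^{(i-2)}-V-P)+(-V^{(i-2)})+(V)+(P)-4(\infty)$. *)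

(* Defs.v *)
From HB Require Import structures.
From mathcomp Require Import all_boot all_order all_algebra.
From mathcomp Require Import ring zify.
From mathcomp Require Import mathcomp_extra boolp classical_sets fsbigop.

Set Implicit Arguments.
Unset Strict Implicit.
Unset Printing Implicit Defensive.

Import Order.TTheory GRing.Theory Num.Theory.
Local Open Scope ring_scope.
Local Open Scope classical_set_scope.

(* y^2 + a1 t y + a3 y = t^3 + a2 t^2 + a4 t + a6 *)
Record wcurve (L : Type) :=
  WCurve { wa1 : L; wa2 : L; wa3 : L; wa4 : L; wa6 : L }.

Definition map_wcurve (L M : Type) (h : L -> M) (E : wcurve L) : wcurve M :=
  WCurve (h (wa1 E)) (h (wa2 E)) (h (wa3 E)) (h (wa4 E)) (h (wa6 E)).

Section Discriminant.
Variables (L : fieldType) (E : wcurve L).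
Let a1 := wa1 E. Let a2 := wa2 E. Let a3 := wa3 E.
Let a4 := wa4 E. Let a6 := wa6 E.
Let b2 := a1 ^+ 2 + 4 * a2.
Let b4 := 2 * a4 + a1 * a3.
Let b6 := a3 ^+ 2 + 4 * a6.
Let b8 := a1 ^+ 2 * a6 + 4 * a2 * a6 - a1 * a3 * a4 + a2 * a3 ^+ 2 - a4 ^+ 2.

Definition discriminant : L :=
  - b2 ^+ 2 * b8 - 8 * b4 ^+ 3 - 27 * b6 ^+ 2 + 9 * b2 * b4 * b6.

Definition elliptic : Prop := discriminant != 0.

End Discriminant.

Inductive ecpoint (L : Type) := Inf | Aff of L & L.
Arguments Inf {L}.

Section GroupLaw.
Variables (L : fieldType) (E : wcurve L).

Definition on_curve (x y : L) : Prop :=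
  y ^+ 2 + wa1 E * x * y + wa3 E * y
  = x ^+ 3 + wa2 E * x ^+ 2 + wa4 E * x + wa6 E.

Definition ec_opp (P : ecpoint L) : ecpoint L :=
  match P with
  | Inf => Inf
  | Aff x y => Aff x (- y - wa1 E * x - wa3 E)
  end.

Definition ec_add (P Q : ecpoint L) : ecpoint L :=
  match P, Q with
  | Inf, _ => Q
  | _, Inf => P
  | Aff x1 y1, Aff x2 y2 =>
    if (x1 == x2) && (y1 + y2 + wa1 E * x2 + wa3 E == 0) then Inf
    else
      let s := if x1 == x2
        then (3 * x1 ^+ 2 + 2 * wa2 E * x1 + wa4 E - wa1 E * y1)
             / (2 * y1 + wa1 E * x1 + wa3 E)
        else (y2 - y1) / (x2 - x1) in
      let x3 := s ^+ 2 + wa1 E * s - wa2 E - x1 - x2 in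
      Aff x3 (- (s + wa1 E) * x3 - (y1 - s * x1) - wa3 E)
  end.

Definition ec_sub (P Q : ecpoint L) : ecpoint L := ec_add P (ec_opp Q).

End GroupLaw.

Definition map_point (L M : Type) (h : L -> M) (P : ecpoint L) : ecpoint M :=
  match P with Inf => Inf | Aff x y => Aff (h x) (h y) end.

(* The coordinate ring L[t, y] of the affine curve, which is free over L[t] with
   basis 1, y: CoordRing E a b stands for a(t) + b(t) y. *)
Record coordring (L : fieldType) (E : wcurve L) : Type :=
  CoordRing { cf0 : {poly L}; cf1 : {poly L} }.

Section CoordRing.
Variables (L : fieldType) (E : wcurve L).
Local Notation R := (coordring E).
Local Notation CR := (CoordRing E).

Definition pair_of_coord (g : R) := (cf0 g, cf1 g).
Definition coord_of_pair (p : {poly L} * {poly L}) : R := CR p.1 p.2.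
Lemma pair_of_coordK : cancel pair_of_coord coord_of_pair.
Proof. by case. Qed.

HB.instance Definition _ := Choice.copy R (can_type pair_of_coordK).

Definition coord_add (g h : R) : R := CR (cf0 g + cf0 h) (cf1 g + cf1 h).
Definition coord_opp (g : R) : R := CR (- cf0 g) (- cf1 g).

Lemma coord_addA : associative coord_add.
Proof. by move=> [? ?] [? ?] [? ?]; rewrite /coord_add /= !addrA. Qed.
Lemma coord_addC : commutative coord_add.
Proof. by move=> [a b] [c d]; rewrite /coord_add /= addrC (addrC b). Qed.
Lemma coord_add0 : left_id (CR 0 0) coord_add.
Proof. by move=> [a b]; rewrite /coord_add /= !add0r. Qed.
Lemma coord_addN : left_inverse (CR 0 0) coord_opp coord_add.
Proof. by move=> [a b]; rewrite /coord_add /= !addNr. Qed.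

HB.instance Definition _ := GRing.isZmodule.Build R
  coord_addA coord_addC coord_add0 coord_addN.

Definition lin_part : {poly L} := (wa1 E)%:P * 'X + (wa3 E)%:P.
Definition cub_part : {poly L} :=
  'X^3 + (wa2 E)%:P * 'X^2 + (wa4 E)%:P * 'X + (wa6 E)%:P.

(* y^2 = cub_part - lin_part * y *)
Definition coord_mul (g h : R) : R :=
  CR (cf0 g * cf0 h + cf1 g * cf1 h * cub_part)
     (cf0 g * cf1 h + cf1 g * cf0 h - cf1 g * cf1 h * lin_part).

Lemma coord_mulA : associative coord_mul.
Proof.
by move=> [a b] [c d] [e f]; rewrite /coord_mul /=; congr CoordRing; ring.
Qed.
Lemma coord_mulC : commutative coord_mul.
Proof. by move=> [a b] [c d]; rewrite /coord_mul /=; congr CoordRing; ring. Qed.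
Lemma coord_mul1 : left_id (CR 1 0) coord_mul.
Proof. by move=> [a b]; rewrite /coord_mul /=; congr CoordRing; ring. Qed.
Lemma coord_mulDl : left_distributive coord_mul coord_add.
Proof.
move=> [a b] [c d] [e f]; rewrite /coord_mul /coord_add /=.
by congr CoordRing; ring.
Qed.
Lemma coord_one_neq0 : CR 1 0 != 0.
Proof. by apply/eqP => -[/eqP]; rewrite oner_eq0. Qed.

HB.instance Definition _ := GRing.Zmodule_isComNzRing.Build R
  coord_mulA coord_mulC coord_mul1 coord_mulDl coord_one_neq0.

Lemma cf0D (g h : R) : cf0 (g + h) = cf0 g + cf0 h. Proof. by []. Qed.
Lemma cf1D (g h : R) : cf1 (g + h) = cf1 g + cf1 h. Proof. by []. Qed.
Lemma cf0M (g h : R) : cf0 (g * h) = cf0 g * cf0 h + cf1 g * cf1 h * cub_part.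
Proof. by []. Qed.
Lemma cf1M (g h : R) :
  cf1 (g * h) = cf0 g * cf1 h + cf1 g * cf0 h - cf1 g * cf1 h * lin_part.
Proof. by []. Qed.
Lemma coord_eqP (g h : R) : cf0 g = cf0 h -> cf1 g = cf1 h -> g = h.
Proof. by case: g h => a b [c d] /= -> ->. Qed.

Definition coord_conj (g : R) : R := CR (cf0 g - cf1 g * lin_part) (- cf1 g).
Definition coord_norm (g : R) : {poly L} :=
  cf0 g ^+ 2 - cf0 g * cf1 g * lin_part - cf1 g ^+ 2 * cub_part.

Lemma coord_conjM (g : R) : coord_conj g * g = CR (coord_norm g) 0.
Proof.
by apply: coord_eqP; rewrite ?cf0M ?cf1M /= /coord_norm; ring.
Qed.

Lemma coord_normM (g h : R) : coord_norm (g * h) = coord_norm g * coord_norm h.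
Proof. by rewrite /coord_norm cf0M cf1M; ring. Qed.

Definition coord_unit : {pred R} := fun g => coord_norm g \is a GRing.unit.
Definition coord_inv (g : R) : R :=
  if coord_unit g then coord_conj g * CR (coord_norm g)^-1 0 else g.

Lemma coord_mulV : {in coord_unit, left_inverse 1 coord_inv *%R}.
Proof.
move=> g gU; rewrite /coord_inv ifT; last exact: gU.
rewrite mulrAC coord_conjM; apply: coord_eqP; rewrite ?cf0M ?cf1M /=.
  by rewrite mulr0 mul0r addr0 mulrV.
by rewrite !(mulr0, mul0r) subr0 addr0.
Qed.
Lemma coord_unitPl (g h : R) : h * g = 1 -> coord_unit g.
Proof.
move=> hg; apply/unitrPr; exists (coord_norm h).
rewrite mulrC -coord_normM hg /coord_norm.
by rewrite /= !(mulr0, mul0r, expr0n, subr0) expr1n.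
Qed.
Lemma coord_inv_out : {in [predC coord_unit], coord_inv =1 id}.
Proof. by move=> g gU; rewrite /coord_inv ifF //; apply: negbTE. Qed.

HB.instance Definition _ := GRing.ComNzRing_hasMulInverse.Build R
  coord_mulV coord_unitPl coord_inv_out.

(* Degree and leading coefficient with respect to the monomials t^i (of degree
   2 i) and t^j y (of degree 2 j + 3); the two families are told apart by the
   parity of the degree.  Both are 0 at 0. *)
Definition coord_deg (g : R) : nat :=
  maxn (size (cf0 g)).-1.*2
    (if cf1 g == 0 then 0%N else ((size (cf1 g)).-1.*2 + 3)%N).
Definition coord_sgn (g : R) : L :=
  if odd (coord_deg g) then lead_coef (cf1 g) else lead_coef (cf0 g).

Lemma coef_top (p q : {poly L}) (i j : nat) :
  (size p <= i.+1)%N -> (size q <= j.+1)%N -> (p * q)`_(i + j) = p`_i * q`_j.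
Proof.
move=> pi qj; have lti : (i < (i + j).+1)%N by rewrite ltnS leq_addr.
rewrite coefM (bigD1 (Ordinal lti)) //= addKn big1 ?addr0 // => k nk.
have [lik|lki] := ltnP i k.
  by rewrite (nth_default _ (leq_trans pi lik)) mul0r.
rewrite [X in _ * X]nth_default ?mulr0 // (leq_trans qj) //.
have {}nk : nat_of_ord k != i by [].
lia.
Qed.

Definition deg_le (n : nat) (g : R) : bool :=
  (size (cf0 g) <= n./2.+1)%N && (size (cf1 g) <= n.-1./2)%N.
Definition deg_coef (n : nat) (g : R) : L :=
  if odd n then (cf1 g)`_(n.-1./2).-1 else (cf0 g)`_(n./2).

Lemma deg_leE (n : nat) (g : R) :
  g != 0 -> deg_le n g = (coord_deg g <= n)%N.
Proof.
case: g => a b g0; rewrite /deg_le /coord_deg /= geq_max -!divn2 -!muln2.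
case: eqP => [->|/eqP b0].
  rewrite size_poly0; move: (size a) => m; apply/andP/andP; lia.
move: b0; rewrite -size_poly_gt0; move: (size a) (size b) => k m m0.
apply/andP/andP; lia.
Qed.

Lemma sgn_deg_coef (g : R) : coord_sgn g = deg_coef (coord_deg g) g.
Proof.
rewrite /coord_sgn /deg_coef; case: g => a b /=; rewrite /coord_deg /=.
case: eqP => [->|/eqP b0]; first by rewrite maxn0 odd_double doubleK lead_coefE.
have sb : (0 < size b)%N by rewrite size_poly_gt0.
case: ifP => o; rewrite lead_coefE.
  congr (_ `_ _); move: o.
  case: leqP => h; last by rewrite odd_double.
  move=> _. by rewrite addn3 /= doubleK.
congr (_ `_ _); move: o.
case: leqP => h; first by rewrite oddD odd_double.
by rewrite doubleK.
Qed.

Lemma coord_sgn_eq0 (g : R) : (coord_sgn g == 0) = (g == 0).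
Proof.
apply/idP/idP => [|/eqP ->]; last first.
  by rewrite /coord_sgn; case: ifP => _; rewrite lead_coef0.
rewrite /coord_sgn; case: g => a b; rewrite /coord_deg /=.
have [->|b0] := eqVneq b 0.
  by rewrite maxn0 odd_double lead_coef_eq0 => /eqP ->; apply/eqP.
case: leqP => h.
  by rewrite oddD odd_double /= lead_coef_eq0 (negbTE b0).
rewrite odd_double /= lead_coef_eq0 => /eqP a0; move: h.
by rewrite a0 size_poly0.
Qed.

Lemma size_lin_part : (size lin_part <= 2)%N.
Proof.
rewrite /lin_part (leq_trans (size_polyD _ _)) // geq_max mul_polyC.
rewrite (leq_trans (size_scale_leq _ _)) ?size_polyX //=.
by rewrite (leq_trans (size_polyC_leq1 _)).
Qed.

Lemma cub_partE : cub_part = 'X^3 + \poly_(i < 3)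
  (if i == 2 then wa2 E else if i == 1 then wa4 E else wa6 E).
Proof.
apply/polyP => i.
rewrite /cub_part !coefD coef_poly !coefCM !coefXn coefX coefC.
by case: i => [|[|[|[|i]]]] /=; ring.
Qed.

Lemma size_cub_part : size cub_part = 4%N.
Proof. by rewrite cub_partE size_polyDl size_polyXn // ltnS size_poly. Qed.

Lemma lead_cub_part : cub_part`_3 = 1.
Proof. by rewrite cub_partE coefD coefXn coef_poly addr0. Qed.

Lemma deg_coef0 (n : nat) : deg_coef n 0 = 0.
Proof. by rewrite /deg_coef; case: ifP; rewrite coef0. Qed.

Lemma size_mul_le (p q : {poly L}) (m n k : nat) :
  (size p <= m)%N -> (size q <= n)%N ->
  (m + n <= k.+1)%N || (m == 0%N) || (n == 0%N) ->
  (size (p * q)%R <= k)%N.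
Proof.
move=> pm qn h.
have [->|p0] := eqVneq p 0; first by rewrite mul0r size_poly0.
have [->|q0] := eqVneq q 0; first by rewrite mulr0 size_poly0.
move: p0 q0; rewrite -!size_poly_gt0 => p0 q0.
apply: leq_trans (size_polyMleq _ _) _; lia.
Qed.

Lemma deg_leM (m n : nat) (g h : R) :
  deg_le m g -> deg_le n h -> deg_le (m + n) (g * h).
Proof.
move=> /andP[ma mb] /andP[na nb]; have := size_cub_part; have := size_lin_part.
move=> sl sc; rewrite /deg_le cf0M cf1M; apply/andP; split.
  rewrite (leq_trans (size_polyD _ _)) // geq_max; apply/andP; split.
    by apply: size_mul_le ma na _; lia.
  have hb : (size (cf1 g * cf1 h)%R <= (m + n)./2 - 2)%N.
    by apply: size_mul_le mb nb _; lia.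
  by apply: size_mul_le hb (eq_leq sc) _; lia.
rewrite (leq_trans (size_polyD _ _)) // geq_max size_polyN; apply/andP; split.
  rewrite (leq_trans (size_polyD _ _)) // geq_max; apply/andP; split.
    by apply: size_mul_le ma nb _; lia.
  by apply: size_mul_le mb na _; lia.
have hb : (size (cf1 g * cf1 h)%R <= (m + n).-1./2 - 1)%N.
  by apply: size_mul_le mb nb _; lia.
by apply: size_mul_le hb sl _; lia.
Qed.
Lemma coef_topM (p q : {poly L}) (m n k : nat) :
  (size p <= m)%N -> (size q <= n)%N -> (m + n = k.+2)%N ->
  (p * q)`_k = p`_m.-1 * q`_n.-1.
Proof.
case: m => [|m].
  by rewrite leqn0 size_poly_eq0 => /eqP ->; rewrite mul0r !coef0 mul0r.
case: n => [|n].
  by rewrite leqn0 size_poly_eq0 => _ /eqP ->; rewrite mulr0 !coef0 mulr0.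
by move=> pm qn /= mn; rewrite -(coef_top pm qn); congr (_ `_ _); lia.
Qed.

Lemma deg_coefM_wlog (m n : nat) (g h : R) : (odd m ==> odd n) ->
  deg_le m g -> deg_le n h ->
  deg_coef (m + n) (g * h) = deg_coef m g * deg_coef n h.
Proof.
move=> omn /andP[ma mb] /andP[na nb].
have := size_cub_part; have := size_lin_part => sl sc.
rewrite /deg_coef oddD cf0M cf1M.
have [om|em] := boolP (odd m).
  have on : odd n by rewrite om in omn.
  rewrite on /= coefD nth_default ?add0r; last first.
    by apply: size_mul_le ma na _; lia.
  have [b0|b0] := eqVneq (cf1 g) 0; first by rewrite b0 !mul0r !coef0 mul0r.
  have [d0|d0] := eqVneq (cf1 h) 0.
    by rewrite d0 mulr0 mul0r !coef0 mulr0.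
  move: b0 d0; rewrite -!size_poly_gt0 => b0 d0.
  have hb : (size (cf1 g * cf1 h)%R <= (m + n)./2 - 2)%N.
    by apply: size_mul_le mb nb _; lia.
  rewrite (coef_topM hb (eq_leq sc)); last lia.
  by rewrite lead_cub_part mulr1 (coef_topM mb nb) //; lia.
have [on|en] /= := boolP (odd n).
  rewrite coefB coefD.
  rewrite [X in _ + X - _]nth_default; last by apply: size_mul_le mb na _; lia.
  have [d0|d0] := eqVneq (cf1 h) 0.
    by rewrite d0 !mulr0 mul0r !coef0 mulr0 addr0 subr0.
  move: d0; rewrite -size_poly_gt0 => d0.
  rewrite (coef_topM ma nb) //; last lia.
  rewrite [X in _ - X]nth_default ?subr0 ?addr0 //.
  have hb : (size (cf1 g * cf1 h)%R <= (m + n).-1./2 - 2)%N.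
    by apply: size_mul_le mb nb _; lia.
  by apply: size_mul_le hb sl _; lia.
rewrite coefD (coef_topM ma na) //; last lia.
rewrite [X in _ + X]nth_default ?addr0 //.
have hb : (size (cf1 g * cf1 h)%R <= (m + n)./2 - 3)%N.
  by apply: size_mul_le mb nb _; lia.
by apply: size_mul_le hb (eq_leq sc) _; lia.
Qed.

Lemma deg_coefM (m n : nat) (g h : R) : deg_le m g -> deg_le n h ->
  deg_coef (m + n) (g * h) = deg_coef m g * deg_coef n h.
Proof.
move=> mg nh; have [o|] := boolP (odd m ==> odd n).
  exact: deg_coefM_wlog.
rewrite negb_imply => /andP[_ on]; rewrite addnC mulrC [RHS]mulrC.
by apply: deg_coefM_wlog => //; rewrite (negbTE on).
Qed.

Lemma coord_deg_le (g : R) : deg_le (coord_deg g) g.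
Proof.
have [->|g0] := eqVneq g 0; last by rewrite deg_leE.
by rewrite /deg_le /= size_poly0.
Qed.

Lemma coord_mul_eq0 : GRing.integral_domain_axiom R.
Proof.
move=> g h gh0; have := deg_coefM (coord_deg_le g) (coord_deg_le h).
rewrite gh0 deg_coef0 -!sgn_deg_coef => /esym/eqP.
by rewrite mulf_eq0 !coord_sgn_eq0.
Qed.

HB.instance Definition _ := GRing.ComUnitRing_isIntegral.Build R coord_mul_eq0.

Lemma coord_degM (g h : R) : g != 0 -> h != 0 ->
  coord_deg (g * h) = (coord_deg g + coord_deg h)%N.
Proof.
move=> g0 h0; have gh0 : g * h != 0 by rewrite mulf_neq0.
have le1 := deg_leM (coord_deg_le g) (coord_deg_le h).
apply/eqP; rewrite eqn_leq -deg_leE // le1 leqNgt; apply/negP => lt.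
have /eqP := deg_coefM (coord_deg_le g) (coord_deg_le h).
rewrite -!sgn_deg_coef.
have : coord_sgn g * coord_sgn h != 0 by rewrite mulf_neq0 ?coord_sgn_eq0.
move=> /[swap] /eqP <-; have := coord_deg_le (g * h); move: lt.
move: (coord_deg _) (_ + _)%N => k n kn /andP[h0' h1'].
rewrite /deg_coef; case: ifP => on; rewrite nth_default ?eqxx //.
  by move: (size _) h1' => s; move: kn on; clear; lia.
by move: (size _) h0' => s; move: kn on; clear; lia.
Qed.

Lemma coord_sgnM (g h : R) : coord_sgn (g * h) = coord_sgn g * coord_sgn h.
Proof.
have [->|g0] := eqVneq g 0; first by rewrite mul0r !sgn_deg_coef !deg_coef0 mul0r.
have [->|h0] := eqVneq h 0; first by rewrite mulr0 !sgn_deg_coef !deg_coef0 mulr0.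
by rewrite !sgn_deg_coef coord_degM // deg_coefM ?coord_deg_le.
Qed.

End CoordRing.

Local Notation "x %:F" := (FracField.tofrac x) : ring_scope.

Section FractionField.
Variable R : idomainType.

Definition frac_num (g : {fraction R}) : R := (frac (repr g)).1.
Definition frac_den (g : {fraction R}) : R := (frac (repr g)).2.

Lemma frac_den_neq0 (g : {fraction R}) : frac_den g != 0.
Proof. exact: denom_ratioP. Qed.

Lemma frac_num_den (g : {fraction R}) : (frac_num g)%:F = g * (frac_den g)%:F.
Proof.
rewrite /frac_num /frac_den -{2}[g]reprK; have := denom_ratioP (repr g).
set x := repr g => dx; rewrite -[RHS]/(FracField.mul _ _).
unlock FracField.tofrac; rewrite -FracField.pi_mul; apply/eqmodP => /=.
rewrite FracField.equivfE /FracField.mulf.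
by rewrite !numden_Ratio ?mulf_neq0 ?oner_eq0 // !mulr1 mul1r mulrC.
Qed.

Lemma frac_num_neq0 (g : {fraction R}) : g != 0 -> frac_num g != 0.
Proof.
by move=> g0; rewrite -tofrac_eq0 frac_num_den mulf_neq0 ?tofrac_eq0
  ?frac_den_neq0.
Qed.

Lemma frac_divE (n d : R) : d != 0 ->
  frac_num (n%:F / d%:F) * d = n * frac_den (n%:F / d%:F).
Proof.
move=> d0; apply/eqP; rewrite -tofrac_eq !rmorphM /= frac_num_den.
by rewrite mulrAC divfK // tofrac_eq0.
Qed.

End FractionField.

Notation funfield E := {fraction (coordring E)}.

Section FunctionField.
Variables (L : fieldType) (E : wcurve L).
Local Notation R := (coordring E).
Local Notation FF := (funfield E).

Definition coordC (c : L) : R := CoordRing E c%:P 0.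
Definition coordT : R := CoordRing E 'X 0.
Definition coordY : R := CoordRing E 0 1.

Lemma coord_weierstrass :
  coordY ^+ 2 + coordC (wa1 E) * coordT * coordY + coordC (wa3 E) * coordY
  = coordT ^+ 3 + coordC (wa2 E) * coordT ^+ 2 + coordC (wa4 E) * coordT
    + coordC (wa6 E).
Proof.
apply: coord_eqP; rewrite !(exprS, expr0, mulr1, cf0D, cf1D, cf0M, cf1M) /=.
  by rewrite /cub_part; ring.
by rewrite /lin_part; ring.
Qed.

Definition frac_deg (g : FF) : int :=
  (coord_deg (frac_num g))%:Z - (coord_deg (frac_den g))%:Z.
Definition frac_sgn (g : FF) : L :=
  coord_sgn (frac_num g) / coord_sgn (frac_den g).

Lemma frac_degE (n d : R) : n != 0 -> d != 0 ->
  frac_deg (n%:F / d%:F) = (coord_deg n)%:Z - (coord_deg d)%:Z.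
Proof.
move=> n0 d0; have := congr1 (@coord_deg _ _) (frac_divE n d0).
have f0 : n%:F / d%:F != 0 by rewrite mulf_neq0 ?invr_eq0 ?tofrac_eq0.
rewrite !coord_degM ?frac_den_neq0 ?frac_num_neq0 // /frac_deg.
by move: (coord_deg (frac_num _)) (coord_deg (frac_den _)) => k l h; lia.
Qed.

Lemma frac_sgnE (n d : R) : d != 0 ->
  frac_sgn (n%:F / d%:F) = coord_sgn n / coord_sgn d.
Proof.
move=> d0; have := congr1 (@coord_sgn _ _) (frac_divE n d0).
rewrite !coord_sgnM /frac_sgn => h.
by apply/eqP; rewrite eqr_div ?coord_sgn_eq0 ?frac_den_neq0 // h.
Qed.

Definition coord_eval (x0 y0 : L) (g : R) : L :=
  (cf0 g).[x0] + (cf1 g).[x0] * y0.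

Lemma coord_evalM (x0 y0 : L) (g h : R) : on_curve E x0 y0 ->
  coord_eval x0 y0 (g * h) = coord_eval x0 y0 g * coord_eval x0 y0 h.
Proof.
move=> EQ; rewrite /coord_eval cf0M cf1M /cub_part /lin_part.
rewrite !(hornerD, hornerN, hornerM, hornerC, hornerX, hornerXn).
have -> : wa6 E = y0 ^+ 2 + wa1 E * x0 * y0 + wa3 E * y0
  - (x0 ^+ 3 + wa2 E * x0 ^+ 2 + wa4 E * x0) by rewrite EQ; ring.
ring.
Qed.

(* The rational function g is regular at (x0, y0), with value c. *)
Definition has_value (g : FF) (x0 y0 c : L) : Prop :=
  exists n d : R, [/\ g = n%:F / d%:F, coord_eval x0 y0 d != 0 &
    c = coord_eval x0 y0 n / coord_eval x0 y0 d].

End FunctionField.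

Section CoefficientMap.
Variables (L : fieldType) (E : wcurve L).

Definition coord_map (h : L -> L) (g : coordring E) : coordring E :=
  CoordRing E (map_poly h (cf0 g)) (map_poly h (cf1 g)).
Definition frac_map (h : L -> L) (g : funfield E) : funfield E :=
  (coord_map h (frac_num g))%:F / (coord_map h (frac_den g))%:F.

Lemma coord_mapM (h : {rmorphism L -> L}) (g1 g2 : coordring E) :
  map_wcurve h E = E ->
  coord_map h (g1 * g2) = coord_map h g1 * coord_map h g2.
Proof.
move=> hE; have h1 : h (wa1 E) = wa1 E := congr1 (@wa1 L) hE.
have h2 : h (wa2 E) = wa2 E := congr1 (@wa2 L) hE.
have h3 : h (wa3 E) = wa3 E := congr1 (@wa3 L) hE.
have h4 : h (wa4 E) = wa4 E := congr1 (@wa4 L) hE.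
have h6 : h (wa6 E) = wa6 E := congr1 (@wa6 L) hE.
apply: coord_eqP; rewrite /coord_map /= ?cf0M ?cf1M /=.
  rewrite !(rmorphD, rmorphM, rmorphXn) /= !map_polyC map_polyX /=.
  by rewrite h2 h4 h6.
rewrite !(rmorphD, rmorphN, rmorphM) /= !map_polyC map_polyX /=.
by rewrite h1 h3.
Qed.

Lemma frac_mapE (h : {rmorphism L -> L}) (n d : coordring E) :
  map_wcurve h E = E -> d != 0 ->
  frac_map h (n%:F / d%:F) = (coord_map h n)%:F / (coord_map h d)%:F.
Proof.
move=> hE d0.
have map_neq0 g : g != 0 -> coord_map h g != 0.
  move=> g0; apply: contra_neq g0 => -[/eqP + /eqP].
  by rewrite !map_poly_eq0 => /eqP g0 /eqP g1; apply: coord_eqP.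
have := congr1 (coord_map h) (frac_divE n d0); rewrite !coord_mapM // => e.
apply/eqP; rewrite eqr_div ?tofrac_eq0 ?map_neq0 ?frac_den_neq0 //.
by rewrite -!tofracM e.
Qed.

End CoefficientMap.

Section Divisor.
Variables (L : fieldType) (E : wcurve L).
Local Notation R := (coordring E).

(* The prime ideal of L[t, y] at an affine point; the point at infinity does
   not belong to Spec L[t, y]. *)
Definition point_ideal (Q : ecpoint L) : set R :=
  match Q with
  | Inf => [set: R]
  | Aff x0 y0 => [set g | coord_eval x0 y0 g = 0]
  end.

Definition ideal_prod (I J : set R) : set R :=
  [set g | exists s : seq (R * R),
     (forall p, p \in s -> I p.1 /\ J p.2) /\ g = \sum_(p <- s) p.1 * p.2].

Definition points_ideal (s : seq (ecpoint L)) : set R :=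
  foldr (fun Q I => ideal_prod (point_ideal Q) I) [set: R] s.

Definition mult_infty (s : seq (ecpoint L)) : nat :=
  count (fun Q => if Q is Inf then true else false) s.

(* div g = sum_(Q in zs) (Q) - sum_(Q in ps) (Q), points being repeated
   according to multiplicity.  Away from infinity the curve is Spec of the
   Dedekind ring L[t, y], where the divisor of g is the factorisation of the
   fractional ideal (g); at infinity, ord g = - deg g. *)
Definition has_divisor (g : funfield E) (zs ps : seq (ecpoint L)) : Prop :=
  [/\ g != 0,
      [set g * h%:F | h in points_ideal ps] = [set h%:F | h in points_ideal zs]
    & - frac_deg g = (mult_infty zs)%:Z - (mult_infty ps)%:Z].

End Divisor.

Section Completion.
Variables (K L : fieldType) (iota : {rmorphism K -> L}).
Variables (degK : K -> int) (degL : L -> int).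

Definition close (N : int) (x y : L) : Prop := x = y \/ degL (x - y) < N.

(* L is the completion of K for the valuation - degK, and - degL is the
   extended valuation; the values of degK and degL at 0 are irrelevant. *)
Record is_completion : Prop := IsCompletion {
  cdegM : forall x y, x != 0 -> y != 0 -> degL (x * y) = degL x + degL y;
  cdegD : forall x y, x != 0 -> y != 0 -> x + y != 0 ->
    degL (x + y) <= Num.max (degL x) (degL y);
  cdeg_ext : forall x, x != 0 -> degL (iota x) = degK x;
  cdense : forall x N, exists z, close N x (iota z);
  ccomplete : forall u : nat -> L,
    (forall N, exists n0, forall m n, (n0 <= m)%N -> (n0 <= n)%N ->
       close N (u m) (u n)) ->
    exists l, forall N, exists n0, forall n, (n0 <= n)%N -> close N (u n) l }.

Definition max_ideal : set L := [set x | x = 0 \/ degL x < 0].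

(* The affine points of the formal group: in the coordinates z = - x / y and
   w = - 1 / y at infinity, z lies in the maximal ideal and w = w(z) is the
   solution in the maximal ideal of the Weierstrass equation. *)
Definition in_formal_group (E : wcurve L) (x y : L) : Prop :=
  [/\ on_curve E x y, y != 0, max_ideal (- (x / y)) & max_ideal (- y^-1)].

End Completion.

Section Frobenius.
Variables (q k : nat) (L : fieldType).

Definition frob (c : L) : L := c ^+ (q ^ k).
Definition ec_frob (Q : ecpoint L) : ecpoint L := map_point frob Q.
Definition twist (E : wcurve L) (g : funfield E) : funfield E := frac_map frob g.

End Frobenius.

Section PowerSums.
Variables (F : finFieldType) (E : wcurve F).

Definition A_monic (i : nat) : set (coordring E) :=
  [set a | coord_deg a = i /\ coord_sgn a = 1].

Definition prime_of (t0 y0 : F) : set (coordring E) :=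
  [set a | exists u v, a = u * (coordT E - coordC E t0)
                         + v * (coordY E - coordC E y0)].

Definition recip_sum (S : set (coordring E)) : funfield E :=
  \sum_(a \in S) (a%:F)^-1.

End PowerSums.
Arguments A_monic {F} E i _.
Arguments prime_of {F} E t0 y0 _.

Section ShtukaFunction.
Variables (F : finFieldType) (E : wcurve F) (L : fieldType).
Variables (iota : {rmorphism funfield E -> L}) (alpha beta : L).

Definition const_emb (c : F) : L := iota (coordC E c)%:F.
Definition curve_ext : wcurve L := map_wcurve const_emb E.
Definition thetaK : L := iota (coordT E)%:F.
Definition etaK : L := iota (coordY E)%:F.

Definition shtuka_m : L :=
  (etaK - frob #|F| 1 beta) / (thetaK - frob #|F| 1 alpha).
Definition shtuka_nu : funfield curve_ext :=
  (coordY curve_ext - coordC curve_ext etaK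
   - coordC curve_ext shtuka_m * (coordT curve_ext - coordC curve_ext thetaK))%:F.
Definition shtuka_f : funfield curve_ext :=
  shtuka_nu / (coordT curve_ext - coordC curve_ext alpha)%:F.

End ShtukaFunction.

(* Main.v *)
(* Let W be an F_q-subspace of A of dimension N.  The polynomial
   e_W(X) = prod_(w in W) (X - w) has the form sum_k e_k X^(q^k), so the sum of
   1 / (a - w) over W is e_0 / e_W(a).  If H in L[t, y] is monic of degree i,
   lies in a + L W and vanishes at Xi^(1), ..., Xi^(N), then applying the
   L-linear functional h |-> sum_k e_k h(Xi^(k)), which kills W, to H - a gives
   e_0 H(Xi) = e_W(a): the power sum is 1 / H(Xi).  The divisors of g, nu and
   t - alpha show that
   H = g^(1) nu^(1) ... nu^(M-1) / ((t - alpha^(1)) ... (t - alpha^(M)))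
   is such a function, with M = i in (a) and M = i - 1 in (b). *)
Require Import Defs.
From HB Require Import structures.
From mathcomp Require Import all_boot all_order all_algebra.
From mathcomp Require Import all_fingroup all_solvable all_field.
From mathcomp Require Import ring zify.
From mathcomp Require Import boolp classical_sets fsbigop.
Set Implicit Arguments.
Unset Strict Implicit.
Unset Printing Implicit Defensive.
Import Order.TTheory GRing.Theory Num.Theory.
Local Open Scope ring_scope.
Local Open Scope classical_set_scope.
Local Notation "x %:F" := (FracField.tofrac x) : ring_scope.

(** Divisors enter only through vanishing. With N = M - 1, the function g vanishes at V and -V^(N),
    and nu^(k) vanishes at Xi^(k), V^(k+1) and -V^(k). The numerator of H therefore vanishes at both
    points over every alpha^(k), and H is a polynomial function once these two points are known to
    differ; this uses smoothness. The count closes because N is the dimension of W, namely i - 1 in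
    (a) and i - 2 in (b): one factor nu^(k) for each required zero Xi^(k).

    Other coincidences are excluded by degrees. The formal group only gives V degrees (2n, 3n); the
    equation V - V^(1) = Xi forces n = 1, so alpha^(k) and theta^(k) have degree 2 q^k. This
    separates different twists but leaves alpha = theta possible, and then H(Xi^(k)) = 0 cannot be
    read off from numerator and denominator. Likewise a difference of points in the divisor of g
    could be the point at infinity, which would lower the degree of H, and this has to be excluded.
    That H(Xi) is not 0 comes from e_W(a) != 0, not from the divisors. *)

Lemma card_pnat_pchar (F : finFieldType) (S : nzRingType)
  (kappa : {rmorphism F -> S}) : [pchar S].-nat #|F|.
Proof.
have [p pr_p chp] := finPcharP F.
have [e] := p_natP (abelem_pgroup (fin_ring_pchar_abelem chp)).
rewrite cardsT => ->; rewrite pnatX; apply/orP; left.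
by rewrite pnatE // (fmorph_pchar kappa).
Qed.

(** * q-linearized polynomials and sums of reciprocals over an F_q-space *)

Section LinearizedPolynomials.
Variables (F : finFieldType) (L : fieldType) (kappa : {rmorphism F -> L}).
Local Notation q := #|F|.

Lemma frobD k : {morph @frob q k L : x y / x + y}.
Proof.
move=> x y; rewrite /frob exprDn_pchar //.
by rewrite pnatX (card_pnat_pchar kappa).
Qed.

Lemma frob_is_zmod k : zmod_morphism (@frob q k L).
Proof.
move=> x y; apply/eqP; rewrite eq_sym subr_eq -frobD subrK //.
Qed.

Lemma frob_is_monoid k : monoid_morphism (@frob q k L).
Proof. by split=> [|x y]; rewrite /frob ?expr1n ?exprMn. Qed.

Definition frob_rmorphism k : {rmorphism L -> L} :=
  HB.pack (@frob q k L) (GRing.isZmodMorphism.Build _ _ _ (frob_is_zmod k))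
    (GRing.isMonoidMorphism.Build _ _ _ (frob_is_monoid k)).

Lemma frob_const k c : frob q k (kappa c) = kappa c.
Proof.
rewrite /frob -rmorphXn /=; congr (kappa _).
by elim: k => [|k IH]; rewrite ?expr1 // expnS exprM expf_card.
Qed.

Lemma frob_frob j k (x : L) : frob q j (frob q k x) = frob q (j + k) x.
Proof. by rewrite /frob -exprM -expnD addnC. Qed.

(** For nonzero [y] this is prod_c (X - c) = X^q - X, evaluated at p / y and multiplied by y^q. For
    [y = 0] both sides are p^q because q > 1. *)
Lemma prod_translates (p : {poly L}) (y : L) :
  \prod_(c : F) (p - (kappa c * y)%:P) = p ^+ q - (y ^+ q.-1)%:P * p.
Proof.
have q1 : (1 < q)%N := finNzRing_gt1 F.
have [->|y0] := eqVneq y 0.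
  under eq_bigr => c _ do rewrite mulr0 subr0.
  rewrite prodr_const expr0n; case: (q) q1 => [|[|n]] //= _.
  by rewrite mul0r subr0.
have := congr1 (fun r => (map_poly kappa r) \Po (y^-1 *: p)) (finField_genPoly F).
rewrite map_prod_XsubC rmorph_prod rmorphB /= map_polyXn map_polyX.
rewrite comp_polyB comp_polyX comp_Xn_poly exprZn.
move/(congr1 (fun r => (y ^+ q)%:P * r)).
rewrite -[X in X%:P * (\prod__ _)]prodr_const rmorph_prod -big_split /=.
rewrite mulrBr !mul_polyC !scalerA.
under [X in _ = X -> _]eq_bigr => c _.
  rewrite comp_polyB comp_polyX comp_polyC mulrBr mul_polyC scalerA.
  rewrite divff // scale1r -polyCM mulrC; over.
move=> <-; rewrite exprVn divff ?expf_neq0 // scale1r.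
by rewrite -{2}(prednK (ltnW q1)) exprSr mulfK // polyC_mulrn.
Qed.

Section Span.
Variables (R : nzRingType) (j : {rmorphism F -> R}) (ev : {rmorphism R -> L}).
Hypothesis evj : forall c, ev (j c) = kappa c.

(** All combinations are listed, with repetitions if [bs] is dependent, so that the span polynomial
    of [b :: bs] is always a product of translates of that of [bs]. Distinctness is proved later for
    the basis in use. *)
Fixpoint fspan (bs : seq R) : seq R :=
  if bs is b :: bs' then [seq j c * b + w | c <- enum F, w <- fspan bs']
  else [:: 0].

Lemma mem_fspan_cons b bs x :
  x \in fspan (b :: bs) <-> exists c w, w \in fspan bs /\ x = j c * b + w.
Proof.
split=> [/allpairsPdep[c [w [_ wbs ->]]]|[c [w [wbs ->]]]]; first by exists c, w.
by apply/allpairsPdep; exists c, w; rewrite mem_enum.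
Qed.

Lemma mem_fspan bs b : b \in bs -> b \in fspan bs.
Proof.
have span0 cs : 0 \in fspan cs.
  elim: cs => [|c cs IH]; first exact: mem_head.
  by apply/mem_fspan_cons; exists 0, 0; rewrite rmorph0 mul0r addr0.
elim: bs => // d bs IH; rewrite inE => /orP[/eqP ->|/IH bbs].
  by apply/mem_fspan_cons; exists 1, 0; rewrite rmorph1 mul1r addr0.
by apply/mem_fspan_cons; exists 0, b; rewrite rmorph0 mul0r add0r.
Qed.

Definition span_poly bs : {poly L} := \prod_(w <- fspan bs) ('X - (ev w)%:P).

(** Induction on the basis. As e_W is additive ([subE]) and F-homogeneous ([scaleE]), the polynomial
    of W + F b is prod_c e_W(X - c b) = prod_c (e_W(X) - c e_W(b)), which [prod_translates] turns
    into e_W^q - e_W(b)^(q-1) e_W. *)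
Lemma span_poly_linearized bs : exists e : nat -> L,
  span_poly bs = \sum_(k < (size bs).+1) e k *: 'X^(q ^ k).
Proof.
elim: bs => [|b bs [e IH]].
  exists (fun=> 1); rewrite /span_poly big_seq1 rmorph0 subr0 big_ord1.
  by rewrite scale1r.
have subE z : span_poly bs \Po ('X - z%:P) = span_poly bs - (span_poly bs).[z]%:P.
  rewrite IH raddf_sum horner_sum raddf_sum -sumrB /=; apply: eq_bigr => k _.
  rewrite comp_polyZ comp_Xn_poly hornerZ hornerXn polyCM mul_polyC -scalerBr.
  congr (_ *: _); rewrite exprDn_pchar; last first.
    by rewrite pnatX (card_pnat_pchar (polyC \o kappa)).
  rewrite -polyCN -!rmorphXn /=; have := raddfN (frob_rmorphism k) z.
  by rewrite /= /frob => ->; rewrite polyCN.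
have scalE c z : (span_poly bs).[kappa c * z] = kappa c * (span_poly bs).[z].
  rewrite IH !horner_sum mulr_sumr; apply: eq_bigr => k _.
  rewrite !hornerZ !hornerXn exprMn; have := frob_const k c.
  by rewrite /frob => ->; exact: mulrCA.
pose Y := (span_poly bs).[ev b] ^+ q.-1.
have rec : \prod_(w <- fspan (b :: bs)) ('X - (ev w)%:P)
    = span_poly bs ^+ q - Y%:P * span_poly bs.
  rewrite -prod_translates [LHS]big_allpairs_dep big_enum /=; apply: eq_bigr => c _.
  rewrite -scalE -subE /span_poly rmorph_prod; apply: eq_bigr => w _.
  rewrite /= comp_polyB comp_polyX comp_polyC rmorphD rmorphM /= evj polyCD.
  by rewrite opprD addrA.
pose n := (size bs).+1.
(* The q-th power moves coefficient k to k + 1. The guard [k < n] cuts off the values of [e] past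
   the last coefficient of e_W, which are arbitrary. *)
exists (fun k => (if k is k'.+1 then e k' ^+ q else 0)
                 - (if (k < n)%N then Y * e k else 0)).
rewrite [LHS](rec : span_poly (b :: bs) = _) IH /=.
under [RHS]eq_bigr => k _ do rewrite scalerBl.
rewrite sumrB; congr (_ - _).
  rewrite [RHS]big_ord_recl /= scale0r add0r.
  have -> : forall (I : Type) (r : seq I) (G : I -> {poly L}),
      (\sum_(i <- r) G i) ^+ q = \sum_(i <- r) G i ^+ q.
    move=> I r G; apply: (big_morph (fun x : {poly L} => x ^+ q)).
      by move=> x y; apply: exprDn_pchar; apply: card_pnat_pchar (polyC \o kappa).
    by rewrite expr0n gtn_eqF // (ltnW (finNzRing_gt1 F)).
  by apply: eq_bigr => k _; rewrite exprZn -exprM -expnSr.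
rewrite [RHS]big_ord_recr /= ltnn scale0r addr0 mulr_sumr; apply: eq_bigr => k _.
by rewrite ltn_ord mul_polyC scalerA.
Qed.

Lemma sum_inv_prod_XsubC (a : L) (ws : seq R) :
  (forall w, w \in ws -> a - ev w != 0) ->
  let p := \prod_(w <- ws) ('X - (ev w)%:P) in
  p.[a] != 0 /\ \sum_(w <- ws) (a - ev w)^-1 = p^`().[a] / p.[a].
Proof.
elim: ws => [|w ws IH] aw /=.
  by rewrite !big_nil hornerC oner_neq0 derivC hornerC mul0r.
have /IH[/= p0 sE] v : v \in ws -> a - ev v != 0.
  by move=> vw; apply: aw; rewrite inE vw orbT.
have w0 : a - ev w != 0 by apply: aw; rewrite mem_head.
rewrite !big_cons sE derivM derivXsubC !(hornerM, hornerD, hornerN, hornerX, hornerC).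
split; first exact: mulf_neq0.
by field; rewrite ?w0 ?p0.
Qed.

Lemma span_poly_root bs w : w \in fspan bs -> (span_poly bs).[ev w] = 0.
Proof.
move=> wb; rewrite /span_poly horner_prod; apply/eqP.
by rewrite prodf_seq_eq0; apply/hasP; exists w => //=; rewrite !hornerE subrr.
Qed.

(** The sum is the logarithmic derivative of e_W at [a]. The derivative of e_W is the constant e_0,
    because q^k = 0 in [L] for k > 0. *)
Lemma sum_inv_translate bs (a : L) :
  (forall w, w \in fspan bs -> a - ev w != 0) ->
  exists e : nat -> L,
  [/\ forall w, w \in fspan bs -> \sum_(k < (size bs).+1) e k * frob q k (ev w) = 0,
      \sum_(k < (size bs).+1) e k * frob q k a != 0 &
      \sum_(w <- fspan bs) (a - ev w)^-1
        = e 0%N / \sum_(k < (size bs).+1) e k * frob q k a].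
Proof.
move=> aw; have [e eE] := span_poly_linearized bs; exists e.
have hE x : (span_poly bs).[x] = \sum_(k < (size bs).+1) e k * frob q k x.
  by rewrite eE horner_sum; apply: eq_bigr => k _; rewrite !hornerE.
have [] := sum_inv_prod_XsubC aw; rewrite -/(span_poly bs) hE => n0 ->.
split=> //; first by move=> w wb; rewrite -hE span_poly_root.
congr (_ / _); rewrite eE raddf_sum /= horner_sum big_ord_recl big1 => [|k _].
  by rewrite derivZ expn0 derivX !hornerE.
rewrite derivZ derivXn hornerZ hornerMn -mulr_natr natrX.
have -> : q%:R = 0 :> L.
  have [p pr_p] := pdivP (finNzRing_gt1 F) => pq.
  have /pcharf0 p0 : p \in [pchar L].
    apply: pnatPpi (card_pnat_pchar kappa) _.
    by rewrite mem_primes pr_p pq (ltnW (finNzRing_gt1 F)).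
  by case/dvdnP: pq => r ->; rewrite natrM p0 mulr0.
by rewrite exprS mul0r !mulr0.
Qed.

End Span.
End LinearizedPolynomials.

(** * Degrees, evaluation and division in L[t, y] *)

Section CoordinateRing.
Variables (L : fieldType) (E : wcurve L).
Local Notation R := (coordring E).
Local Notation C := (@coordC L E).
Local Notation T := (coordT E).
Local Notation Y := (coordY E).
Implicit Types (g h : R) (c x y : L).

Lemma coordC_is_zmod : zmod_morphism C.
Proof. by move=> c d; apply: coord_eqP; rewrite /= ?oppr0 ?addr0 // polyCB. Qed.

Lemma coordC_is_monoid : monoid_morphism C.
Proof.
split=> [//|c d]; apply: coord_eqP; rewrite ?cf0M ?cf1M /= ?polyCM; ring.
Qed.

Definition coordC_rmorphism : {rmorphism L -> R} :=
  HB.pack C (GRing.isZmodMorphism.Build _ _ _ coordC_is_zmod)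
    (GRing.isMonoidMorphism.Build _ _ _ coordC_is_monoid).

Lemma coord_evalB x y g h :
  coord_eval x y (g - h) = coord_eval x y g - coord_eval x y h.
Proof.
rewrite /coord_eval -[cf0 (g - h)]/(cf0 g - cf0 h) -[cf1 (g - h)]/(cf1 g - cf1 h).
by rewrite !(hornerD, hornerN); ring.
Qed.

Lemma coord_evalD x y g h :
  coord_eval x y (g + h) = coord_eval x y g + coord_eval x y h.
Proof. rewrite /coord_eval cf0D cf1D !hornerD; ring. Qed.

Lemma coord_evalC x y c : coord_eval x y (C c) = c.
Proof. by rewrite /coord_eval !hornerE. Qed.

Lemma coord_evalT x y : coord_eval x y T = x.
Proof. by rewrite /coord_eval !hornerE. Qed.

Lemma coord_evalY x y : coord_eval x y Y = y.
Proof. by rewrite /coord_eval !hornerE. Qed.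

Lemma coord_eval_prod x y (I : Type) (r : seq I) (P : pred I) (G : I -> R) :
  on_curve E x y ->
  coord_eval x y (\prod_(i <- r | P i) G i)
  = \prod_(i <- r | P i) coord_eval x y (G i).
Proof.
move=> xyE; apply: (big_morph (coord_eval x y)); last exact: coord_evalC.
by move=> g h; apply: coord_evalM.
Qed.

Lemma mul_coordC c g : C c * g = CoordRing E (c *: cf0 g) (c *: cf1 g).
Proof.
by apply: coord_eqP; rewrite ?cf0M ?cf1M /= ?mul0r ?subr0 ?addr0 mul_polyC.
Qed.

Lemma coord_eval_scale x y c g : coord_eval x y (C c * g) = c * coord_eval x y g.
Proof. rewrite mul_coordC /coord_eval /= !hornerE; ring. Qed.

Lemma deg_leB n g h : deg_le n g -> deg_le n h -> deg_le n (g - h).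
Proof.
move=> /andP[g0 g1] /andP[h0 h1]; rewrite /deg_le /=.
by rewrite !(leq_trans (size_polyD _ _)) ?geq_max ?size_polyN ?g0 ?g1.
Qed.

Lemma deg_le_scale n c g : deg_le n g -> deg_le n (C c * g).
Proof.
move=> /andP[g0 g1]; rewrite mul_coordC /deg_le /=.
by rewrite !(leq_trans (size_scale_leq _ _)).
Qed.

Lemma deg_leW m n g : (m <= n)%N -> deg_le m g -> deg_le n g.
Proof.
move=> mn /andP[g0 g1]; apply/andP.
by split; [apply: leq_trans g0 _ | apply: leq_trans g1 _]; lia.
Qed.

Lemma deg_coefB n g h : deg_coef n (g - h) = deg_coef n g - deg_coef n h.
Proof. by rewrite /deg_coef; case: ifP; rewrite coefB. Qed.

Lemma deg_coefD n g h : deg_coef n (g + h) = deg_coef n g + deg_coef n h.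
Proof. by rewrite /deg_coef; case: ifP; rewrite coefD. Qed.

Lemma deg_coef_scale n c g : deg_coef n (C c * g) = c * deg_coef n g.
Proof. by rewrite mul_coordC /deg_coef; case: ifP; rewrite coefZ. Qed.

Lemma deg_le_pred n g : deg_le n.+2 g -> deg_coef n.+2 g = 0 -> deg_le n.+1 g.
Proof.
have size_pred (p : {poly L}) k : (size p <= k.+1)%N -> p`_k = 0 -> (size p <= k)%N.
  move=> pk pk0; rewrite leqNgt; apply/negP => kp.
  have sp : size p = k.+1 by apply/eqP; rewrite eqn_leq pk.
  by have := lead_coef_eq0 p; rewrite lead_coefE sp /= pk0 eqxx -size_poly_eq0 sp.
move=> /andP[g0 g1]; rewrite /deg_coef /deg_le.
case: ifP => o c0; apply/andP; split; try by [apply: leq_trans g0 _; lia].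
- apply: leq_trans (size_pred _ (n.+2.-1./2).-1 _ c0) _; last by lia.
  by apply: leq_trans g1 _; lia.
- by apply: leq_trans (size_pred _ _ g0 c0) _; lia.
- by apply: leq_trans g1 _; lia.
Qed.

Lemma deg_coef_small n g : deg_le n g -> deg_coef n.+1 g = 0.
Proof.
move=> /andP[g0 g1]; rewrite /deg_coef; case: ifP => o; rewrite nth_default //.
  by apply: leq_trans g1 _; lia.
by apply: leq_trans g0 _; lia.
Qed.

Lemma deg_le_const g : deg_le 1 g -> exists c, g = C c.
Proof.
move=> /andP[g0]; rewrite leqn0 size_poly_eq0 => /eqP g1.
by exists (cf0 g)`_0; apply: coord_eqP; rewrite //= -(size1_polyC g0).
Qed.

Lemma deg_leC n c : deg_le n (C c).
Proof. by rewrite /deg_le /= size_poly0 (leq_trans (size_polyC_leq1 _)). Qed.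

(** No monomial has degree 1: truncated subtraction makes [monom 1] equal to y. Hence the degree
    lemmas below are stated at [d.+2]. *)
Definition monom d : R :=
  if odd d then CoordRing E 0 'X^(d.-1./2.-1) else CoordRing E 'X^(d./2) 0.

Lemma deg_le_monom d : deg_le d.+2 (monom d.+2).
Proof.
rewrite /monom /deg_le; case: ifP => o /=; rewrite size_poly0 size_polyXn ?andbT.
  by apply/andP; split; lia.
by rewrite ltnSn.
Qed.

Lemma deg_coef_monom d : deg_coef d.+2 (monom d.+2) = 1.
Proof. by rewrite /monom /deg_coef; case: (odd d.+2); rewrite coefXn eqxx. Qed.

(** Trades degree and sign for a degree bound and one coefficient, which behave well under linear
    combinations. *)
Lemma coord_deg_sgn n g : (0 < n)%N ->
  coord_deg g = n /\ coord_sgn g = 1 <-> deg_le n g /\ deg_coef n g = 1.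
Proof.
move=> n0; split=> [[<- <-]|[gn g1]].
  by rewrite sgn_deg_coef coord_deg_le.
have g0 : g != 0.
  by apply: contra_eq_neq g1 => ->; rewrite deg_coef0 eq_sym oner_neq0.
have dg : coord_deg g = n.
  apply/eqP; rewrite eqn_leq -deg_leE // gn leqNgt -(prednK n0) ltnS -deg_leE //.
  by apply: contra_eqN g1 => /deg_coef_small; rewrite prednK // eq_sym => ->;
    rewrite oner_neq0.
by rewrite sgn_deg_coef dg.
Qed.

Lemma coord_sgnC c : coord_sgn (C c) = c.
Proof. by rewrite /coord_sgn /coord_deg /= eqxx maxn0 odd_double lead_coefC. Qed.

Section Basis.
Variables (x0 y0 : L).
Hypothesis xy0 : on_curve E x0 y0.

(** Normalising each monomial to vanish at the point lets one family serve both power sums: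
    adjoining 1 gives all functions of bounded degree, leaving it out gives those in the ideal of
    the point. *)
Definition rmonom d : R := monom d - C (coord_eval x0 y0 (monom d)).

Lemma deg_le_rmonom d : deg_le d.+2 (rmonom d.+2).
Proof. by rewrite deg_leB ?deg_le_monom ?deg_leC. Qed.

Lemma deg_coef_rmonom d : deg_coef d.+2 (rmonom d.+2) = 1.
Proof.
rewrite deg_coefB deg_coef_monom [deg_coef _ (C _)]deg_coef_small ?subr0 //.
exact: deg_leC.
Qed.

Lemma eval_rmonom d : coord_eval x0 y0 (rmonom d) = 0.
Proof. by rewrite coord_evalB coord_evalC subrr. Qed.

Lemma deg_le_reduce n g : deg_le n.+2 g ->
  deg_le n.+1 (g - C (deg_coef n.+2 g) * rmonom n.+2).
Proof.
move=> gn; apply: deg_le_pred; first by rewrite deg_leB ?deg_le_scale ?deg_le_rmonom.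
by rewrite deg_coefB deg_coef_scale deg_coef_rmonom mulr1 subrr.
Qed.

(* A basis of the functions of degree at most n + 1, or of the subspace of those
   vanishing at (x0, y0), according to whether b is false or true. *)
Fixpoint rbasis (b : bool) n : seq R :=
  if n is n'.+1 then rmonom n'.+2 :: rbasis b n'
  else if b then [::] else [:: 1].

Lemma size_rbasis b n : size (rbasis b n) = (n + ~~ b)%N.
Proof. by elim: n => [|n /= ->]; case: b. Qed.

(** Clearing the top coefficient with [rmonom] lowers the degree bound and keeps the value at the
    point. The descent ends in a constant, which is a multiple of the basis element 1 or, when [b]
    holds, is 0. *)
Lemma functional_eq0 (phi : R -> L) b n g :
  (forall g h, phi (g - h) = phi g - phi h) ->
  (forall c g, phi (C c * g) = c * phi g) ->
  (forall h, h \in rbasis b n -> phi h = 0) ->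
  deg_le n.+1 g -> (b -> coord_eval x0 y0 g = 0) -> phi g = 0.
Proof.
move=> phiB phiZ; elim: n g => [|n IH] g ph0 gn gb.
  have [c cE] := deg_le_const gn; move: gb ph0; rewrite cE coord_evalC.
  case: b => c0 ph0.
    by rewrite c0 // -[C 0]/(0 : R) -[0](mul0r 0) -{1}[0]/(C 0) phiZ mul0r.
  by rewrite -[C c]mulr1 phiZ ph0 ?mulr0 ?mem_head.
have -> : g = (g - C (deg_coef n.+2 g) * rmonom n.+2)
              - C (- deg_coef n.+2 g) * rmonom n.+2.
  by rewrite !mul_coordC; apply: coord_eqP => /=; rewrite scaleNr; ring.
rewrite phiB phiZ [phi (rmonom _)]ph0 ?mem_head // mulr0 subr0.
apply: IH => [h hb|//|bT]; first by apply: ph0; rewrite inE hb orbT.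
- exact: deg_le_reduce.
- by rewrite coord_evalB coord_eval_scale eval_rmonom gb // mulr0 subr0.
Qed.

End Basis.

(** If a(x) + b(x) y vanishes for two values of y, then a(x) = b(x) = 0. Division in L[t, y] thus
    reduces to dividing two polynomials in t. *)
Lemma coord_dvd_prod (xs : seq L) g : uniq xs ->
  (forall x, x \in xs -> exists y y', [/\ y != y', coord_eval x y g = 0
                                       & coord_eval x y' g = 0]) ->
  exists h, g = h * \prod_(x <- xs) (T - C x).
Proof.
move=> ux gx.
have root_g x : x \in xs -> root (cf0 g) x && root (cf1 g) x.
  move=> /gx[y [y' [yy' e e']]]; rewrite /root; move: e e'; rewrite /coord_eval.
  set a := (cf0 g).[x]; set b := (cf1 g).[x] => e e'.
  have b0 : b = 0.
    have /eqP : b * (y - y') = 0 by rewrite mulrBr -(subrr 0) -{1}e -e'; ring.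
    by rewrite mulf_eq0 subr_eq0 (negbTE yy') orbF => /eqP.
  by move: e; rewrite b0 mul0r addr0 => ->; rewrite eqxx.
have dvd (p : {poly L}) : all (root p) xs ->
    exists r, p = r * \prod_(x <- xs) ('X - x%:P).
  move=> px; have := uniq_roots_dvdp px; rewrite uniq_rootsE => /(_ ux).
  by move=> /dvdpP.
have /dvd[a aE] : all (root (cf0 g)) xs by apply/allP => x /root_g /andP[].
have /dvd[b bE] : all (root (cf1 g)) xs by apply/allP => x /root_g /andP[].
exists (CoordRing E a b).
have -> : \prod_(x <- xs) (T - C x) = CoordRing E (\prod_(x <- xs) ('X - x%:P)) 0.
  elim: (xs) => [|x s IH]; rewrite ?big_nil ?big_cons // IH.
  by apply: coord_eqP; rewrite ?cf0M ?cf1M /=; ring.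
by apply: coord_eqP; rewrite ?cf0M ?cf1M /= ?aE ?bE; ring.
Qed.

Lemma prime_of_eval x0 y0 : on_curve E x0 y0 ->
  forall g, (exists u v, g = u * (T - C x0) + v * (Y - C y0))
            <-> coord_eval x0 y0 g = 0.
Proof.
move=> xy g; split=> [[u [v ->]]|g0].
  rewrite coord_evalD !coord_evalM // !coord_evalB !coord_evalC.
  by rewrite coord_evalT coord_evalY !subrr !mulr0 addr0.
have dvd (p : {poly L}) : exists r, p - p.[x0]%:P = r * ('X - x0%:P).
  by apply/factor_theorem; rewrite /root !hornerE subrr.
have [r0 r0E] := dvd (cf0 g); have [r1 r1E] := dvd (cf1 g).
(* Expanding both coefficients at [x0] leaves a remainder cf0(x0) + cf1(x0) y, which is cf1(x0) (y -
   y0) because g vanishes at the point. *)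
exists (CoordRing E r0 r1), (C (cf1 g).[x0]).
have e0 : cf0 g = r0 * ('X - x0%:P) + (cf0 g).[x0]%:P by rewrite -r0E subrK.
have e1 : cf1 g = r1 * ('X - x0%:P) + (cf1 g).[x0]%:P by rewrite -r1E subrK.
have c0 : (cf0 g).[x0]%:P = - ((cf1 g).[x0]%:P * y0%:P) :> {poly L}.
  by rewrite -polyCM -polyCN; congr _%:P; apply/eqP; rewrite -addr_eq0 -g0.
apply: coord_eqP; rewrite ?cf0D ?cf1D ?cf0M ?cf1M /=.
  by rewrite {1}e0 c0; ring.
by rewrite {1}e1; ring.
Qed.

Section Map.
Variable s : {rmorphism L -> L}.
Hypothesis sE : map_wcurve s E = E.

Lemma coord_map_eval x y g :
  coord_eval (s x) (s y) (coord_map s g) = s (coord_eval x y g).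
Proof. by rewrite /coord_eval !horner_map rmorphD rmorphM. Qed.

Lemma coord_deg_map g : coord_deg (coord_map s g) = coord_deg g.
Proof. by rewrite /coord_deg /= !size_map_poly map_poly_eq0. Qed.

Lemma coord_sgn_map g : coord_sgn (coord_map s g) = s (coord_sgn g).
Proof. by rewrite /coord_sgn coord_deg_map; case: ifP; rewrite lead_coef_map. Qed.

Lemma on_curve_map x y : on_curve E x y -> on_curve E (s x) (s y).
Proof.
rewrite /on_curve => /(congr1 s); rewrite !(rmorphD, rmorphM, rmorphXn) /=.
have [h1 h2 h3 h4 h6] : [/\ s (wa1 E) = wa1 E, s (wa2 E) = wa2 E,
  s (wa3 E) = wa3 E, s (wa4 E) = wa4 E & s (wa6 E) = wa6 E].
  by split; [rewrite -[in RHS]sE..].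
by rewrite h1 h2 h3 h4 h6.
Qed.

End Map.
End CoordinateRing.

(** * From power sums to interpolation at the twists of Xi *)

Section ReciprocalSums.
Variables (F : finFieldType) (E : wcurve F).
Local Notation R := (coordring E).
Local Notation q := #|F|.
Local Notation span := (fspan (coordC_rmorphism E)).

Section Points.
Variables (t0 y0 : F).

Lemma mem_fspan_rbasis b n (x : R) :
  x \in span (rbasis E t0 y0 b n) <->
  deg_le n.+1 x /\ (b -> coord_eval t0 y0 x = 0).
Proof.
elim: n x => [|n IH] x.
  case: b.
    rewrite /= inE; split=> [/eqP ->|[x1 /(_ isT)]].
      by split=> [|_]; [exact: (deg_leC E 1 0) | exact: (coord_evalC E t0 y0 0)].
    by have [c ->] := deg_le_const x1; rewrite coord_evalC => ->; apply/eqP.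
  split=> [/mem_fspan_cons[c [w []]]|[x1 _]].
    by rewrite /= inE => /eqP -> ->; rewrite mulr1 addr0; split=> //; apply: deg_leC.
  have [c ->] := deg_le_const x1; apply/mem_fspan_cons; exists c, 0.
  by rewrite mem_head mulr1 addr0.
split=> [/mem_fspan_cons[c [w [/IH[w1 wb] ->]]]|[x1 xb]].
  have -> : coordC E c * rmonom E t0 y0 n.+2 + w
            = w - coordC E (- c) * rmonom E t0 y0 n.+2.
    have -> : coordC E (- c) = - coordC E c := raddfN (coordC_rmorphism E) c.
    by ring.
  split=> [|bT].
    by rewrite deg_leB ?deg_le_scale ?deg_le_rmonom // (deg_leW _ w1).
  by rewrite coord_evalB coord_eval_scale eval_rmonom wb // mulr0 subr0.
apply/mem_fspan_cons; exists (deg_coef n.+2 x),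
  (x - coordC E (deg_coef n.+2 x) * rmonom E t0 y0 n.+2).
split; last by rewrite [RHS]addrC subrK.
apply/IH; split=> [|bT].
  exact: deg_le_reduce.
by rewrite coord_evalB coord_eval_scale eval_rmonom xb // mulr0 subr0.
Qed.

(** The basis is triangular for the degree: the top coefficient of a combination recovers the scalar
    of the newest basis element. *)
Lemma uniq_fspan_rbasis b n : uniq (span (rbasis E t0 y0 b n)).
Proof.
have uniq_cons (d : R) k bs : deg_coef k d = 1 ->
    (forall w, w \in span bs -> deg_coef k w = 0) -> uniq (span bs) ->
    uniq (span (d :: bs)).
  move=> d1 w0 ubs; apply: allpairs_uniq_dep; rewrite ?enum_uniq //.
  move=> _ _ /allpairsPdep[c [w [_ wbs ->]]] /allpairsPdep[c' [w' [_ wbs' ->]]] /=.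
  move=> e; have : deg_coef k (coordC E c * d + w) = deg_coef k (coordC E c' * d + w').
    exact: congr1 e.
  rewrite !deg_coefD !deg_coef_scale (w0 w) // (w0 w') // d1 !mulr1 !addr0 => cc.
  by move: e; rewrite cc => /addrI ->.
elim: n => [|n IH] /=.
  case: b => //; apply: (uniq_cons _ 0%N) => //.
    by rewrite /deg_coef /= coefC.
  by move=> w; rewrite inE => /eqP ->; rewrite deg_coef0.
apply: (uniq_cons _ n.+2) => //; first exact: deg_coef_rmonom.
by move=> w /mem_fspan_rbasis[/deg_coef_small].
Qed.

Definition monic_vanishing (b : bool) i : set R :=
  [set a | (coord_deg a = i /\ coord_sgn a = 1) /\ (b -> coord_eval t0 y0 a = 0)].

Lemma monic_vanishingE b n :
  monic_vanishing b n.+2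
  = [set` [seq rmonom E t0 y0 n.+2 - w | w <- span (rbasis E t0 y0 b n)]].
Proof.
apply/seteqP; split=> a /=.
  move=> [/coord_deg_sgn[]// an a1 ab].
  apply/mapP; exists (rmonom E t0 y0 n.+2 - a); last by rewrite subKr.
  apply/mem_fspan_rbasis; split=> [|bT]; last first.
    by rewrite coord_evalB eval_rmonom ab // subr0.
  apply: deg_le_pred; first by rewrite deg_leB ?deg_le_rmonom.
  by rewrite deg_coefB deg_coef_rmonom a1 subrr.
case/mapP => w /mem_fspan_rbasis[w1 wb] ->; split=> [|bT].
  apply/coord_deg_sgn => //; split.
    by rewrite deg_leB ?deg_le_rmonom // (deg_leW _ w1).
  by rewrite deg_coefB deg_coef_rmonom deg_coef_small // subr0.
by rewrite coord_evalB eval_rmonom wb // subr0.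
Qed.

Lemma recip_sum_monic b n :
  recip_sum (monic_vanishing b n.+2)
  = \sum_(w <- span (rbasis E t0 y0 b n)) ((rmonom E t0 y0 n.+2 - w)%:F)^-1.
Proof.
rewrite /recip_sum monic_vanishingE -fsbig_seq ?big_map //.
rewrite map_inj_uniq ?uniq_fspan_rbasis // => x y /addrI; exact: oppr_inj.
Qed.

End Points.

Lemma monomE (L : fieldType) (EL : wcurve L) d :
  monom EL d = if odd d then coordT EL ^+ d.-1./2.-1 * coordY EL
               else coordT EL ^+ d./2.
Proof.
have TE k : coordT EL ^+ k = CoordRing EL 'X^k 0.
  elim: k => [//|k IH]; rewrite exprS IH.
  by apply: coord_eqP; rewrite ?cf0M ?cf1M /= ?exprS; ring.
rewrite /monom; case: ifP => _; rewrite TE //.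
by apply: coord_eqP; rewrite ?cf0M ?cf1M /=; ring.
Qed.

Section Embedding.
Variables (L : fieldType) (iota : {rmorphism funfield E -> L}).
Local Notation EL := (curve_ext iota).
Local Notation theta := (thetaK iota).
Local Notation eta := (etaK iota).

Definition ev : {rmorphism R -> L} := iota \o @FracField.tofrac R.
Definition kappa : {rmorphism F -> L} := ev \o coordC_rmorphism E.

Lemma kappaE : const_emb iota = kappa. Proof. by []. Qed.

Lemma on_curve_kappa t0 y0 : on_curve E t0 y0 -> on_curve EL (kappa t0) (kappa y0).
Proof.
by move=> /(congr1 kappa); rewrite !(rmorphD, rmorphM, rmorphXn).
Qed.

Lemma on_curve_Xi : on_curve EL theta eta.
Proof.
have := congr1 ev (coord_weierstrass E).
by rewrite !(rmorphD, rmorphM, rmorphXn).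
Qed.

Lemma frob_curve k : map_wcurve (frob_rmorphism kappa k) EL = EL.
Proof. by rewrite /curve_ext /map_wcurve /= kappaE !frob_const. Qed.

Lemma ev_inj : injective ev.
Proof. by move=> a b /fmorph_inj/eqP; rewrite tofrac_eq => /eqP. Qed.

Lemma coord_eval_monom x y d : on_curve EL x y ->
  coord_eval x y (monom EL d) = if odd d then x ^+ d.-1./2.-1 * y else x ^+ d./2.
Proof.
move=> xy; have evX k : coord_eval x y (coordT EL ^+ k) = x ^+ k.
  elim: k => [|k IH]; first exact: (coord_evalC EL x y 1).
  by rewrite !exprS coord_evalM // coord_evalT IH.
by rewrite monomE; case: ifP => _; rewrite ?coord_evalM // evX ?coord_evalY.
Qed.

(** Frobenius fixes the coefficients, which come from [F], so evaluating at Xi^(k) is the q^k-th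
    power of evaluating at Xi. This turns a linearized polynomial in w(Xi) into a linear functional
    of w. *)
Lemma coord_eval_rmonom t0 y0 d k : on_curve E t0 y0 ->
  coord_eval (frob q k theta) (frob q k eta) (rmonom EL (kappa t0) (kappa y0) d)
  = frob q k (ev (rmonom E t0 y0 d)).
Proof.
move=> ty; rewrite coord_evalB coord_evalC.
have evF : kappa (coord_eval t0 y0 (monom E d))
           = coord_eval (kappa t0) (kappa y0) (monom EL d).
  rewrite coord_eval_monom; last exact: on_curve_kappa.
  have evX j : coord_eval t0 y0 (coordT E ^+ j) = t0 ^+ j.
    elim: j => [|j IH]; first exact: (coord_evalC E t0 y0 1).
    by rewrite !exprS coord_evalM // coord_evalT IH.
  rewrite monomE; case: ifP => _; rewrite ?coord_evalM // evX ?coord_evalY.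
    by rewrite rmorphM rmorphXn.
  by rewrite rmorphXn.
rewrite -evF /rmonom [ev _]rmorphB -[RHS]/(frob_rmorphism kappa k _) rmorphB /=.
congr (_ - _); last exact/esym/(frob_const kappa k).
have on_k := on_curve_map (frob_curve k) on_curve_Xi.
rewrite coord_eval_monom //; have -> : iota (monom E d)%:F
    = if odd d then theta ^+ d.-1./2.-1 * eta else theta ^+ d./2.
  rewrite monomE; case: ifP => _.
    by rewrite -[LHS]/(ev _) rmorphM rmorphXn.
  by rewrite -[LHS]/(ev _) rmorphXn.
rewrite -[RHS]/(frob_rmorphism kappa k _).
by case: ifP => _; rewrite ?rmorphM rmorphXn.
Qed.

Lemma mem_rbasis_lift t0 y0 b n h : on_curve E t0 y0 ->
  h \in rbasis EL (kappa t0) (kappa y0) b n ->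
  exists2 g, g \in rbasis E t0 y0 b n &
    forall k, coord_eval (frob q k theta) (frob q k eta) h = frob q k (ev g).
Proof.
move=> ty; elim: n => [|n IH] /=.
  case: b => //; rewrite inE => /eqP ->; exists 1; first exact: mem_head.
  move=> k; rewrite rmorph1 -[RHS]/(frob_rmorphism kappa k 1) rmorph1.
  exact: (coord_evalC EL _ _ 1).
rewrite inE => /orP[/eqP ->|/IH[g gb gE]].
  exists (rmonom E t0 y0 n.+2); first exact: mem_head.
  by move=> k; rewrite coord_eval_rmonom.
by exists g => //; rewrite inE gb orbT.
Qed.

Lemma recip_sum_interpolation t0 y0 (b : bool) n (H : coordring EL) : on_curve E t0 y0 ->
  deg_le n.+2 H -> deg_coef n.+2 H = 1 ->
  (b -> coord_eval (kappa t0) (kappa y0) H = 0) ->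
  (forall k, (k < n + ~~ b)%N ->
     coord_eval (frob q k.+1 theta) (frob q k.+1 eta) H = 0) ->
  coord_eval theta eta H != 0 /\
  iota (recip_sum (monic_vanishing t0 y0 b n.+2)) = (coord_eval theta eta H)^-1.
Proof.
move=> ty Hn H1 Hb HXi; rewrite recip_sum_monic rmorph_sum /=.
set bs := rbasis E t0 y0 b n; set a := rmonom E t0 y0 n.+2.
under eq_bigr => w _ do rewrite fmorphV -[iota _]/(ev _) rmorphB.
have aw w : w \in span bs -> ev a - ev w != 0.
  move=> /mem_fspan_rbasis[w1 _]; rewrite subr_eq0 (inj_eq ev_inj).
  apply/eqP => /(congr1 (deg_coef n.+2)); rewrite deg_coef_rmonom.
  by rewrite deg_coef_small // => /eqP; rewrite oner_eq0.
have [e [e0 ea ->]] := sum_inv_translate (kappa := kappa) (fun=> erefl) aw.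
pose phi h := \sum_(k < (size bs).+1)
  e k * coord_eval (frob q k theta) (frob q k eta) (h : coordring EL).
have phiB g h : phi (g - h) = phi g - phi h.
  by rewrite /phi -sumrB; apply: eq_bigr => k _; rewrite coord_evalB mulrBr.
have phiZ c h : phi (coordC EL c * h) = c * phi h.
  rewrite /phi mulr_sumr; apply: eq_bigr => k _.
  by rewrite coord_eval_scale mulrCA.
have phi_basis h : h \in rbasis EL (kappa t0) (kappa y0) b n -> phi h = 0.
  move=> /(mem_rbasis_lift ty)[g gb gE]; rewrite -[RHS](e0 g) ?mem_fspan //.
  by apply: eq_bigr => k _; rewrite gE.
pose aL := rmonom EL (kappa t0) (kappa y0) n.+2.
(* Both functions have degree n + 2 and leading coefficient 1, and both vanish at P when [b] holds;
   the difference lies in the L-span of the basis. *)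
have /eqP : phi (H - aL) = 0.
  apply: (functional_eq0 phiB phiZ phi_basis) => [|bT].
    apply: deg_le_pred; first by rewrite deg_leB ?deg_le_rmonom.
    by rewrite deg_coefB deg_coef_rmonom H1 subrr.
  by rewrite coord_evalB eval_rmonom Hb // subr0.
rewrite phiB subr_eq0 => /eqP phiH.
have phi_a : phi aL = \sum_(k < (size bs).+1) e k * frob q k (ev a).
  by apply: eq_bigr => k _; rewrite coord_eval_rmonom.
rewrite -phi_a -phiH in ea *.
(* The basis has exactly as many elements as H has prescribed zeros Xi^(1), Xi^(2), ..., so only k =
   0 survives. *)
have phiHE : phi H = e 0%N * coord_eval theta eta H.
  rewrite /phi big_ord_recl big1 ?addr0 => [|k _]; first by rewrite /frob !expr1.
  by rewrite HXi ?mulr0 // -(size_rbasis E t0 y0).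
(* [ea] now says that e_0 H(Xi) = e_W(a) is nonzero, so neither factor vanishes. *)
move: ea; rewrite phiHE mulf_eq0 negb_or => /andP[e00 HXi0].
by split=> //; rewrite invfM mulrA divff // mul1r.
Qed.

End Embedding.
End ReciprocalSums.

(** * Degree calculus in the completion *)

Section Degrees.
Variables (F : finFieldType) (E : wcurve F) (L : fieldType).
Variables (iota : {rmorphism funfield E -> L}) (deg : L -> int).
Hypothesis hK : is_completion iota (@frac_deg F E) deg.
Local Notation q := #|F|.
Local Notation EL := (curve_ext iota).
Local Notation theta := (thetaK iota).
Local Notation eta := (etaK iota).
Local Notation kp := (kappa iota).

(** [deg 0] carries no information: exact degrees include [x != 0], and upper bounds admit [x = 0]
    separately. *)
Definition isdeg (x : L) (n : int) := x != 0 /\ deg x = n.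
Definition degle (x : L) (n : int) := x = 0 \/ deg x <= n.

Lemma isdeg_degle x n : isdeg x n -> degle x n.
Proof. by move=> [_ <-]; right. Qed.

Lemma degleW x m n : m <= n -> degle x m -> degle x n.
Proof. by move=> mn [->|xm]; [left | right; apply: le_trans mn]. Qed.

Lemma isdeg_le x m n : isdeg x m -> degle x n -> m <= n.
Proof. by move=> [x0 <-] [x00|//]; rewrite x00 eqxx in x0. Qed.

Lemma isdeg_inj x m n : isdeg x m -> isdeg x n -> m = n.
Proof. by move=> [_ <-] [_ <-]. Qed.

Lemma degleM x y m n : degle x m -> degle y n -> degle (x * y) (m + n).
Proof.
move=> [->|xm]; first by rewrite mul0r; left.
move=> [->|yn]; first by rewrite mulr0; left.
have [->|x0] := eqVneq x 0; first by rewrite mul0r; left.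
have [->|y0] := eqVneq y 0; first by rewrite mulr0; left.
by right; rewrite (cdegM hK) // lerD.
Qed.

Lemma isdegM x y m n : isdeg x m -> isdeg y n -> isdeg (x * y) (m + n).
Proof.
by move=> [x0 <-] [y0 <-]; split; [rewrite mulf_neq0 | rewrite (cdegM hK)].
Qed.

Lemma isdegX x m k : isdeg x m -> isdeg (x ^+ k) (m * k%:Z).
Proof.
move=> xm; elim: k => [|k IH].
  split; first exact: oner_neq0.
  have := cdegM hK (oner_neq0 L) (oner_neq0 L); rewrite mulr1 expr0 mulr0.
  by move: (deg 1) => d; lia.
rewrite exprS (_ : m * _ = m + m * k%:Z); first exact: isdegM.
by rewrite -add1n PoszD mulrDr mulr1.
Qed.

Lemma isdeg1 : isdeg 1 0.
Proof. by have := isdegX 0 (conj (oner_neq0 L) (erefl (deg 1))); rewrite mulr0. Qed.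

Lemma isdegN x m : isdeg x m -> isdeg (- x) m.
Proof.
move=> xm; have N10 : (-1 : L) != 0 by rewrite oppr_eq0 oner_neq0.
have e := cdegM hK N10 N10; rewrite mulrNN mulr1 (proj2 isdeg1) in e.
rewrite -mulN1r -[m]add0r; apply: isdegM => //; split=> //.
by move: (deg (-1)) e => d; lia.
Qed.

Lemma degleN x m : degle x m -> degle (- x) m.
Proof.
have [->|x0] := eqVneq x 0; first by rewrite oppr0.
case=> [xx|xm]; first by rewrite xx oppr0; left.
by right; rewrite (proj2 (isdegN (conj x0 erefl))).
Qed.

Lemma degleD x y m : degle x m -> degle y m -> degle (x + y) m.
Proof.
move=> [->|xm]; first by rewrite add0r.
move=> [->|yn]; first by rewrite addr0; right.
have [->|x0] := eqVneq x 0; first by rewrite add0r; right.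
have [->|y0] := eqVneq y 0; first by rewrite addr0; right.
have [->|xy0] := eqVneq (x + y) 0; first by left.
by right; apply: le_trans (cdegD hK x0 y0 xy0) _; rewrite ge_max xm.
Qed.

Lemma isdegD x y m : isdeg x m -> degle y (m - 1) -> isdeg (x + y) m.
Proof.
move=> xm ym.
have xy0 : x + y != 0.
  apply/eqP => /eqP; rewrite addr_eq0 => /eqP xE.
  by have := isdeg_le xm; rewrite xE => /(_ _ (degleN ym)); lia.
split=> //; have [xyle|h] : degle (x + y) m.
- by apply: degleD (isdeg_degle xm) _; apply: degleW ym; lia.
- by rewrite xyle eqxx in xy0.
apply/eqP; rewrite eq_le h /= leNgt; apply/negP => lt.
have : degle (x + y - y) (m - 1).
  by apply: degleD; [right; move: lt; clear; lia | exact: degleN].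
by rewrite addrK => /(isdeg_le xm); lia.
Qed.

Lemma isdegB x y m : isdeg x m -> degle y (m - 1) -> isdeg (x - y) m.
Proof. by move=> xm ym; apply: isdegD xm _; apply: degleN. Qed.

Lemma isdegBr x y m : isdeg y m -> degle x (m - 1) -> isdeg (x - y) m.
Proof. by move=> ym xm; rewrite addrC; apply: isdegD (isdegN ym) xm. Qed.

Lemma isdeg_frob k x m : isdeg x m -> isdeg (frob q k x) (m * (q ^ k)%:Z).
Proof. exact: isdegX. Qed.

Lemma isdeg_ev a : a != 0 -> isdeg (ev iota a) (coord_deg a)%:Z.
Proof.
move=> a0; split; first by rewrite fmorph_eq0 tofrac_eq0.
have := frac_degE a0 (oner_neq0 (coordring E)); rewrite tofrac1 divr1.
rewrite [X in _ - Posz X]/coord_deg /= eqxx maxn0 size_polyC oner_neq0 subr0 => <-.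
by apply: (cdeg_ext hK); rewrite tofrac_eq0.
Qed.

Lemma isdeg_kappa c : c != 0 -> isdeg (kp c) 0.
Proof.
move=> c0; have c1 : coordC E c != 0 by rewrite (fmorph_eq0 (coordC_rmorphism E)).
have := isdeg_ev c1.
by rewrite /coord_deg /= eqxx maxn0 size_polyC c0.
Qed.

Lemma degle_kappa c : degle (kp c) 0.
Proof.
have [->|c0] := eqVneq c 0; first by left; rewrite rmorph0.
exact: isdeg_degle (isdeg_kappa c0).
Qed.

Lemma isdeg_theta : isdeg theta 2.
Proof.
have T0 : coordT E != 0.
  by apply/eqP => /(congr1 (@cf0 _ _)) /eqP; rewrite polyX_eq0.
by have := isdeg_ev T0; rewrite /coord_deg /= eqxx size_polyX.
Qed.

Lemma isdeg_eta : isdeg eta 3.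
Proof.
have Y0 : coordY E != 0.
  by apply/eqP => /(congr1 (@cf1 _ _)) /eqP; rewrite oner_eq0.
by have := isdeg_ev Y0; rewrite /coord_deg /= oner_eq0 size_poly0 size_poly1.
Qed.

(* In characteristic 2 the left-hand side is a1 x + a3, and a curve with
   a1 = a3 = 0 is then singular. *)
Lemma not_two_torsion x y : elliptic E -> isdeg x 2 -> isdeg y 3 ->
  2 * y + wa1 EL * x + wa3 EL != 0.
Proof.
move=> hE x2 y3; rewrite -[wa1 EL]/(kp (wa1 E)) -[wa3 EL]/(kp (wa3 E)).
have [two0|two0] := eqVneq (2 : F) 0.
  have -> : (2 : L) = 0 by rewrite -(rmorph_nat kp) two0 rmorph0.
  rewrite mul0r add0r.
  have [a10|a10] := eqVneq (wa1 E) 0.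
    rewrite a10 rmorph0 mul0r add0r fmorph_eq0.
    apply: contraNneq hE => a30; rewrite /discriminant a10 a30.
    set a2 := wa2 E; set a4 := wa4 E; set a6 := wa6 E.
    apply/eqP; transitivity (2 * (- 8 * a2 ^+ 2 * (4 * a2 * a6 - a4 ^+ 2)
      - 32 * a4 ^+ 3 - 216 * a6 ^+ 2 + 144 * a2 * a4 * a6)); first by ring.
    by rewrite two0 mul0r.
  have [] // := isdegD (isdegM (isdeg_kappa a10) x2) (y := kp (wa3 E)).
  by apply: degleW (degle_kappa _).
have y3' : isdeg (2 * y) 3.
  rewrite -(rmorph_nat kp) -[3]add0r.
  exact: isdegM (isdeg_kappa two0) y3.
rewrite -addrA; have [] // := isdegD y3' (y := kp (wa1 E) * x + kp (wa3 E)).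
apply: degleD; last by apply: degleW (degle_kappa _).
by rewrite -[3 - 1]add0r; apply: degleM (degle_kappa _) (isdeg_degle _).
Qed.

End Degrees.

(* V, -V1 and -(theta, eta) are collinear, hence so are V1, (theta, eta) and -V. *)
Lemma chord_geometry (L : fieldType) (E : wcurve L) (al be al1 be1 th et : L) :
  al != al1 -> th != al1 ->
  ec_sub E (Aff al be) (Aff al1 be1) = Aff th et ->
  let m := (et - be1) / (th - al1) in
  al = m ^+ 2 + wa1 E * m - wa2 E - th - al1 /\
  et + m * (al - th) = - be - wa1 E * al - wa3 E.
Proof.
move=> al01 th01; rewrite /ec_sub /= (negbTE al01) /=.
set s := (_ / (al1 - al)) => -[thE etE]; set m := (et - be1) / (th - al1).
have sE : s * (al1 - al) = - be1 - wa1 E * al1 - wa3 E - be.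
  by rewrite /s divfK // subr_eq0 eq_sym.
(* Negation (x, y) -> (x, - y - a1 x - a3) sends a line of slope s to one of slope - s - a1. *)
have mE : m = - s - wa1 E.
  apply: (mulIf (_ : th - al1 != 0)); first by rewrite subr_eq0.
  rewrite /m divfK ?subr_eq0 // -etE; rewrite thE.
  have -> : be1 = - s * (al1 - al) - wa1 E * al1 - wa3 E - be by rewrite mulNr sE; ring.
  ring.
split; first by rewrite mE -thE; ring.
by rewrite mE -etE thE; ring.
Qed.

(** * The line through Xi, V^(1) and -V, and its norm *)

Section Line.
Variables (L : fieldType) (E : wcurve L) (al be al1 be1 th et : L).
Hypotheses (al01 : al != al1) (th01 : th != al1).
Hypothesis chord : ec_sub E (Aff al be) (Aff al1 be1) = Aff th et.
Hypotheses (th_curve : on_curve E th et) (al1_curve : on_curve E al1 be1).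
Let m := (et - be1) / (th - al1).
Local Notation C := (coordC E).
Local Notation T := (coordT E).

Definition line := coordY E - C et - C m * (T - C th).

Lemma lineE : line = CoordRing E (- et%:P - m *: ('X - th%:P)) 1.
Proof.
rewrite /line mul_coordC; apply: coord_eqP.
  by rewrite -[LHS]/(0 - et%:P - m *: ('X - th%:P)) sub0r.
by rewrite -[LHS]/(1 - 0 - m *: (0 - 0)) !subr0 scaler0 subr0.
Qed.

Lemma coord_eval_line x y : coord_eval x y line = y - et - m * (x - th).
Proof.
by rewrite !coord_evalB coord_eval_scale coord_evalB !coord_evalC coord_evalT coord_evalY.
Qed.

Lemma deg_sgn_line : coord_deg line = 3%N /\ coord_sgn line = 1.
Proof.
apply/coord_deg_sgn => //; rewrite lineE /deg_le /deg_coef /= coefC /=.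
split=> //; rewrite size_poly1 andbT.
rewrite (leq_trans (size_polyD _ _)) // geq_max !size_polyN.
rewrite (leq_trans (size_polyC_leq1 _)) //=.
by rewrite (leq_trans (size_scale_leq _ _)) // size_XsubC.
Qed.

Lemma line_Xi : coord_eval th et line = 0.
Proof. by rewrite coord_eval_line !subrr mulr0 subrr. Qed.

Lemma line_V1 : coord_eval al1 be1 line = 0.
Proof.
rewrite coord_eval_line.
have -> : m * (al1 - th) = be1 - et; last by ring.
by rewrite -opprB mulrN /m divfK ?subr_eq0 // opprB.
Qed.

Lemma line_oppV : coord_eval al (- be - wa1 E * al - wa3 E) line = 0.
Proof.
rewrite coord_eval_line; have [_] := chord_geometry al01 th01 chord.
by rewrite -/m => <-; ring.
Qed.

(** The norm of the line is minus a monic cubic in t. The formula for [al] matches the coefficient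
    of t^2, so the two sides differ by a polynomial u t + v; it vanishes at the distinct points [th]
    and [al1], hence is 0. *)
Lemma conj_line : coord_conj line * line = - ((T - C th) * (T - C al) * (T - C al1)).
Proof.
have [alE _] := chord_geometry al01 th01 chord; rewrite -/m in alE.
rewrite coord_conjM.
pose c := et - m * th.
pose u := 2 * c * m + wa1 E * c + wa3 E * m - wa4 E + (th * al + th * al1 + al * al1).
pose v := c ^+ 2 + wa3 E * c - wa6 E - th * al * al1.
have be1E : be1 = c + m * al1.
  have : m * (th - al1) = et - be1 by rewrite /m divfK ?subr_eq0.
  by rewrite /c => h; rewrite -[be1](subKr et) -h; ring.
have uth : u * th + v = 0.
  move: th_curve; rewrite /on_curve => /eqP; rewrite -subr_eq0 => /eqP h.
  by rewrite -h /u /v (_ : et = c + m * th) ?/c; [rewrite alE; ring | ring].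
have ual1 : u * al1 + v = 0.
  move: al1_curve; rewrite /on_curve be1E => /eqP; rewrite -subr_eq0 => /eqP h.
  by rewrite -h /u /v alE; ring.
have u0 : u = 0.
  have /eqP : u * (th - al1) = 0 by rewrite mulrBr -(subrr 0) -{1}uth -ual1; ring.
  by rewrite mulf_eq0 subr_eq0 (negbTE th01) orbF => /eqP.
have v0 : v = 0 by rewrite -uth u0 mul0r add0r.
have -> : coord_norm line
          = - (('X - th%:P) * ('X - al%:P) * ('X - al1%:P)) + u%:P * 'X + v%:P.
  rewrite lineE /coord_norm /lin_part /cub_part /= /u /v /c -mul_polyC alE.
  by rewrite !(polyCD, polyCB, polyCN, polyCM, polyC_exp); ring.
rewrite u0 v0 mul0r !addr0; apply: coord_eqP.
  by rewrite -[cf0 (- _)]/(- cf0 _) !cf0M !cf1M /=; ring.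
by rewrite -[cf1 (- _)]/(- cf1 _) !cf1M !cf0M /=; ring.
Qed.

(** The conjugate at Xi is the line at -Xi. As the line vanishes at Xi, this is the difference of
    the two y-coordinates, nonzero when Xi is not 2-torsion. *)
Lemma conj_line_Xi : coord_eval th et (coord_conj line) = - (2 * et + wa1 E * th + wa3 E).
Proof.
rewrite lineE /coord_eval /coord_conj /= /lin_part !hornerE; ring.
Qed.

End Line.

Lemma on_curve_opp (L : fieldType) (E : wcurve L) x y :
  on_curve E x y -> on_curve E x (- y - wa1 E * x - wa3 E).
Proof. by rewrite /on_curve => <-; ring. Qed.

Lemma coord_monic_prod (L : fieldType) (E : wcurve L) (d : nat) (r : seq nat)
  (G : nat -> coordring E) :
  (forall k, coord_deg (G k) = d /\ coord_sgn (G k) = 1) ->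
  coord_deg (\prod_(k <- r) G k) = (d * size r)%N /\
  coord_sgn (\prod_(k <- r) G k) = 1.
Proof.
move=> Gd; elim: r => [|k r [IHd IHs]].
  rewrite big_nil muln0; split; last exact: (coord_sgnC E 1).
  by rewrite /coord_deg /= eqxx maxn0 size_polyC oner_neq0.
have [Gk Gs] := Gd k.
rewrite big_cons coord_sgnM IHs Gs mulr1; split=> //.
by rewrite coord_degM ?IHd ?Gk ?mulnS // -coord_sgn_eq0 ?IHs ?Gs oner_neq0.
Qed.

Lemma deg_sgn_TsubC (L : fieldType) (E : wcurve L) c :
  coord_deg (coordT E - coordC E c) = 2%N /\ coord_sgn (coordT E - coordC E c) = 1.
Proof.
apply/coord_deg_sgn => //.
have -> : coordT E - coordC E c = CoordRing E ('X - c%:P) 0.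
  by apply: coord_eqP => //; rewrite -[LHS]/(0 - 0) subr0.
rewrite /deg_le /deg_coef /= size_poly0 size_XsubC; split=> //.
by rewrite coefB coefX coefC subr0.
Qed.

(** Here u = nu^(M), which cancels against the numerator of the last factor f^(M); x = g^(1), y is
    the product of the other nu^(k), and v that of the t - alpha^(k). What remains is 1 / H. *)
Lemma div_cancel (K : fieldType) (u v x y : K) :
  u != 0 -> v != 0 -> x != 0 -> y != 0 -> u / (x * (y * u / v)) = v / (x * y).
Proof. by move=> u0 v0 x0 y0; field; rewrite u0 v0 x0 y0. Qed.

(** * The degrees of V, and the positions of the twists of V and Xi *)

Section Shtuka.
Variables (F : finFieldType) (E : wcurve F) (hE : elliptic E).
Variables (L : fieldType) (iota : {rmorphism funfield E -> L}) (deg : L -> int).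
Hypothesis hK : is_completion iota (@frac_deg F E) deg.
Local Notation q := #|F|.
Local Notation EL := (curve_ext iota).
Local Notation theta := (thetaK iota).
Local Notation eta := (etaK iota).
Local Notation kp := (kappa iota).
Local Notation fr := (frob_rmorphism kp).
Local Notation isd := (isdeg deg).
Local Notation dle := (degle deg).
Variables (al be : L).
Hypothesis hV : in_formal_group deg EL al be.
Hypothesis hXi : ec_sub EL (Aff al be) (ec_frob q 1 (Aff al be)) = Aff theta eta.
Local Notation x_ k := (frob q k al).
Local Notation y_ k := (frob q k be).

Let q2 : 2 <= q%:Z. Proof. exact: finNzRing_gt1 F. Qed.

(** The coordinates z and w of the formal group give deg beta >= 1 and deg alpha < deg beta, so
    beta^2 dominates its side of the Weierstrass equation. If alpha had degree at most 0, so would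
    the other side; hence alpha^3 dominates there, and 2 deg beta = 3 deg alpha. *)
Lemma formal_degrees : exists n : int, [/\ 1 <= n, isd al (2 * n) & isd be (3 * n)].
Proof.
have [cur b0 zM wM] := hV; set db := deg be.
have bd : isd be db by [].
have db0 : 1 <= db.
  case: wM => [/eqP|w0]; first by rewrite oppr_eq0 invr_eq0 (negbTE b0).
  have w_ : isd (- be^-1) (deg (- be^-1)) by split; rewrite // oppr_eq0 invr_eq0.
  have := isdegM hK bd w_; rewrite mulrN divff // => /isdeg_inj.
  by move=> /(_ _ (isdegN hK (isdeg1 hK))); move: w0; clear; lia.
have a_lt : dle al (db - 1).
  have z_lt : dle (- (al / be)) (-1).
    by case: zM => [->|z0]; [left | right; move: z0; clear; lia].
  have := degleM hK (degleN hK z_lt) (isdeg_degle bd).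
  by rewrite opprK divfK // addrC.
have kle := degle_kappa hK.
have lhs : isd (be ^+ 2 + (wa1 EL * al * be + wa3 EL * be)) (2 * db).
  apply: (isdegD hK) => //; first by rewrite mulrC; apply: (isdegX hK).
  apply: (degleD hK) => //.
    apply: degleW (degleM hK (degleM hK (kle _) a_lt) (isdeg_degle bd)).
    by clear; lia.
  by apply: degleW (degleM hK (kle _) (isdeg_degle bd)); move: db0; clear; lia.
have {}cur : be ^+ 2 + (wa1 EL * al * be + wa3 EL * be)
  = al ^+ 3 + (wa2 EL * al ^+ 2 + wa4 EL * al + wa6 EL).
  by move: cur; rewrite /on_curve !addrA.
have [a0|a1] : dle al 0 \/ isd al (deg al) /\ 1 <= deg al.
- have [->|an0] := eqVneq al 0; first by left; left.
  by case: (lerP (deg al) 0) => h; [left; right | right; split=> //; move: h; clear; lia].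
- have a3 k : dle (al ^+ k) 0.
    elim: k => [|k IH]; first exact: isdeg_degle (isdeg1 hK).
    by rewrite exprS -[0]addr0; apply: (degleM hK).
  have /(isdeg_le lhs) : dle (be ^+ 2 + (wa1 EL * al * be + wa3 EL * be)) 0.
    rewrite cur; apply: (degleD hK) => //; apply: (degleD hK) => //; last exact: kle.
    by apply: (degleD hK) => //; rewrite -[0]addr0; apply: (degleM hK) => //; exact: kle.
  by move: db0; clear; lia.
case: a1 => ad a1; set da := deg al in ad a1.
have rhs : isd (be ^+ 2 + (wa1 EL * al * be + wa3 EL * be)) (da * 3).
  rewrite cur; apply: (isdegD hK) => //; first exact: (isdegX hK).
  apply: (degleD hK) => //; first apply: (degleD hK) => //.
  - apply: degleW (degleM hK (kle _) (isdeg_degle (isdegX hK 2 ad))).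
    by move: a1; clear; lia.
  - by apply: degleW (degleM hK (kle _) (isdeg_degle ad)); move: a1; clear; lia.
  - by apply: degleW (kle _); move: a1; clear; lia.
have e := isdeg_inj lhs rhs; exists (db - da).
have [ea eb] : da = 2 * (db - da) /\ db = 3 * (db - da) by move: e; clear; lia.
by rewrite -ea -eb; split=> //; move: ea a1; clear; lia.
Qed.

(** The slope m has degree 3nq - 2nq = nq. If n >= 2, V dominates Xi, and in eta + m (alpha - theta)
    = - beta - a1 alpha - a3 the degrees nq + 2n and 3n would have to agree, contradicting q >=
    2. *)
Lemma V_degrees : isd al 2 /\ isd be 3.
Proof.
have [n [n1 ad bd]] := formal_degrees.
have thd := isdeg_theta hK; have etd := isdeg_eta hK; have kle := degle_kappa hK.
have a1d : isd (x_ 1) (2 * (n * q%:Z)) by rewrite mulrA; apply: (isdeg_frob hK 1 ad).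
have b1d : isd (y_ 1) (3 * (n * q%:Z)) by rewrite mulrA; apply: (isdeg_frob hK 1 bd).
have nq : 2 * n <= n * q%:Z.
  by rewrite mulrC ler_pM2l //; move: n1; clear; lia.
have thx : isd (theta - x_ 1) (2 * (n * q%:Z)).
  apply: (isdegBr hK) => //; apply: degleW (isdeg_degle thd).
  by move: nq n1; clear; lia.
have th01 : theta != x_ 1 by rewrite -subr_eq0; case: thx.
have al01 : al != x_ 1.
  by apply/eqP => aE; move: a1d; rewrite -aE => /(isdeg_inj ad); move: nq n1; clear; lia.
have := chord_geometry al01 th01 hXi.
set m := _ / _ => /= -[_ mE].
have md : isd m (n * q%:Z).
  have mt : m * (theta - x_ 1) = eta - y_ 1 by rewrite /m divfK // subr_eq0.
  have etx : isd (eta - y_ 1) (3 * (n * q%:Z)).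
    apply: (isdegBr hK) => //; apply: degleW (isdeg_degle etd).
    by move: nq n1; clear; lia.
  have m0 : m != 0 by apply: contraTneq (proj1 etx) => m0; rewrite -mt m0 mul0r eqxx.
  have := isdegM hK (conj m0 erefl) thx; rewrite mt => /(isdeg_inj etx) e.
  by split=> //; move: e; clear; lia.
suff n_1 : n = 1 by move: ad bd; rewrite n_1.
have [/eqP|th_al] := eqVneq theta al.
  move=> /eqP tE; move: ad; rewrite -tE => /(isdeg_inj thd).
  by clear; lia.
have [//|n2] : n = 1 \/ 2 <= n by move: n1; clear; lia.
have rhs : isd (be + (eta + wa1 EL * al + wa3 EL)) (3 * n).
  apply: (isdegD hK) => //; apply: (degleD hK) => //; first apply: (degleD hK) => //.
  - by apply: degleW (isdeg_degle etd); move: n2; clear; lia.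
  - by apply: degleW (degleM hK (kle _) (isdeg_degle ad)); move: n2; clear; lia.
  - by apply: degleW (kle _); move: n2; clear; lia.
have tad : isd (al - theta) (2 * n).
  by apply: (isdegB hK) => //; apply: degleW (isdeg_degle thd); move: n2; clear; lia.
have := isdegN hK (isdegM hK md tad).
have -> : - (m * (al - theta)) = be + (eta + wa1 EL * al + wa3 EL).
  by rewrite -[m * _](addKr eta) mE; ring.
by move=> /(isdeg_inj rhs); move: nq n1; clear; lia.
Qed.

Lemma x_deg k : isd (x_ k) (2 * (q ^ k)%:Z).
Proof. by have [ad _] := V_degrees; apply: (isdeg_frob hK). Qed.

Lemma y_deg k : isd (y_ k) (3 * (q ^ k)%:Z).
Proof. by have [_ bd] := V_degrees; apply: (isdeg_frob hK). Qed.

(** Source of all inequalities between theta^(k) and alpha^(l) for k != l; the case k = l stays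
    undecided. *)
Lemma isdeg2_neq u v k l : isd u (2 * (q ^ k)%:Z) -> isd v (2 * (q ^ l)%:Z) ->
  k != l -> u != v.
Proof.
move=> ud vd; apply: contra_neq => uv; move: ud; rewrite uv => /(isdeg_inj vd) e.
apply: (@expnI q); first exact: finNzRing_gt1.
by move: e; move: (q ^ k)%N (q ^ l)%N; clear; lia.
Qed.

Lemma theta_deg k : isd (frob q k theta) (2 * (q ^ k)%:Z).
Proof. exact: (isdeg_frob hK k (isdeg_theta hK)). Qed.

Lemma theta_neq_x k : theta != x_ k.+1.
Proof. by apply: (isdeg2_neq (k := 0) _ (x_deg k.+1)) => //; exact: isdeg_theta hK. Qed.

Lemma x_neq k l : k != l -> x_ k != x_ l.
Proof. exact: isdeg2_neq (x_deg k) (x_deg l). Qed.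

Lemma al_neq_x k : al != x_ k.+1.
Proof. by rewrite -[al in X in X != _]expr1 (x_neq (k := 0)). Qed.

Lemma kappa_neq_x c k : kp c != x_ k.
Proof.
have [c0|c0] := eqVneq c 0.
  by rewrite c0 rmorph0 eq_sym; case: (x_deg k).
apply/eqP => cE; have := isdeg_kappa hK c0; rewrite cE => /(isdeg_inj (x_deg k)).
have : (0 < q ^ k)%N by rewrite expn_gt0 (ltnW (finNzRing_gt1 F)).
by move: (q ^ k)%N; clear; lia.
Qed.

Lemma V_on_curve : on_curve EL al be. Proof. by case: hV. Qed.

Lemma x_on_curve k : on_curve EL (x_ k) (y_ k).
Proof. exact: (on_curve_map (frob_curve iota k) V_on_curve). Qed.

Definition nu0 := line EL (x_ 1) (y_ 1) theta eta.

Lemma shtuka_nuE : shtuka_nu iota al be = nu0%:F. Proof. by []. Qed.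

Local Notation cm k := (coord_map (@frob q k L)).
Local Notation T := (coordT EL).
Local Notation C := (coordC EL).
Local Notation yo k := (- y_ k - wa1 EL * x_ k - wa3 EL).

Lemma frob_oppV j k : frob q j (yo k) = yo (j + k).
Proof.
have c1 : fr j (wa1 EL) = wa1 EL := congr1 (@wa1 L) (frob_curve iota j).
have c3 : fr j (wa3 EL) = wa3 EL := congr1 (@wa3 L) (frob_curve iota j).
rewrite -[LHS]/(fr j _) !(rmorphB, rmorphN, rmorphM) c1 c3.
by rewrite -[fr j (y_ k)]/(frob q j _) -[fr j (x_ k)]/(frob q j _) !frob_frob.
Qed.

Lemma frob_eval k (g : coordring EL) x y :
  coord_eval (frob q k x) (frob q k y) (cm k g) = frob q k (coord_eval x y g).
Proof. exact: (coord_map_eval (fr k)). Qed.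

Lemma frob0 k : frob q k (0 : L) = 0. Proof. exact: (rmorph0 (fr k)). Qed.

Lemma cm_TsubC k c : cm k (T - C c) = T - C (frob q k c).
Proof.
apply: coord_eqP.
  rewrite -[LHS]/(map_poly (fr k) ('X - c%:P)) -[RHS]/('X - (fr k c)%:P).
  by rewrite rmorphB; congr (_ - _); [apply: map_polyX | apply: map_polyC].
by rewrite -[LHS]/(map_poly (fr k) (0 - 0)) -[RHS]/(0 - 0) subr0 rmorph0.
Qed.

Lemma cmM k (g h : coordring EL) : cm k (g * h) = cm k g * cm k h.
Proof. exact: (coord_mapM (h := fr k) _ _ (frob_curve iota k)). Qed.

Lemma twist_tofrac k (g : coordring EL) : twist q k (g%:F : funfield EL) = (cm k g)%:F.
Proof.
have := frac_mapE (h := fr k) g (frob_curve iota k) (oner_neq0 _).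
rewrite tofrac1 divr1 => e; rewrite -[LHS]/(frac_map (fr k) g%:F) e.
have -> : coord_map (fr k) 1 = 1 :> coordring EL.
  apply: coord_eqP; first exact: (rmorph1 (map_poly (fr k))).
  exact: (rmorph0 (map_poly (fr k))).
by rewrite tofrac1 divr1.
Qed.

Lemma twist_f k :
  twist q k (shtuka_f iota al be) = (cm k nu0)%:F / (T - C (x_ k))%:F.
Proof.
have d0 : T - C al != 0.
  by rewrite -coord_sgn_eq0 (proj2 (deg_sgn_TsubC _ _)) oner_neq0.
have := frac_mapE (h := fr k) nu0 (frob_curve iota k) d0.
by rewrite [coord_map (fr k) (T - _)]cm_TsubC.
Qed.

Lemma cm_eval0 k (g : coordring EL) x y :
  coord_eval x y g = 0 -> coord_eval (frob q k x) (frob q k y) (cm k g) = 0.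
Proof. by rewrite frob_eval => ->; apply: frob0. Qed.

Lemma prod_seq_eq0 (r : seq nat) (G : nat -> L) k :
  k \in r -> G k = 0 -> \prod_(j <- r) G j = 0.
Proof.
move=> kr Gk; apply/eqP; rewrite prodf_seq_eq0; apply/hasP.
by exists k => //=; rewrite Gk.
Qed.

Lemma nu0_geometry :
  [/\ coord_eval theta eta nu0 = 0, coord_eval (x_ 1) (y_ 1) nu0 = 0,
      coord_eval al (- be - wa1 EL * al - wa3 EL) nu0 = 0 &
      coord_conj nu0 * nu0 = - ((T - C theta) * (T - C al) * (T - C (x_ 1)))].
Proof.
split; first exact: line_Xi.
- by apply: line_V1; exact: theta_neq_x.
- by apply: line_oppV hXi; [exact: al_neq_x | exact: theta_neq_x].
- apply: conj_line hXi _ _; first exact: al_neq_x.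
  + exact: theta_neq_x.
  + exact: on_curve_Xi.
  + exact: x_on_curve.
Qed.

Lemma monic_neq0 (g : coordring EL) : coord_sgn g = 1 -> g != 0.
Proof. by move=> g1; rewrite -coord_sgn_eq0 g1 oner_neq0. Qed.

Lemma cm_nu0_monic k : coord_deg (cm k nu0) = 3%N /\ coord_sgn (cm k nu0) = 1.
Proof.
have [nd ns] := deg_sgn_line EL (x_ 1) (y_ 1) theta eta.
split; first by rewrite (coord_deg_map (fr k)).
by rewrite (coord_sgn_map (fr k)) ns rmorph1.
Qed.

(** * The interpolating function H *)

Section Interpolant.
Variables (h : coordring EL) (N : nat).
Hypotheses (hV0 : coord_eval al be h = 0) (hVN : coord_eval (x_ N) (yo N) h = 0).

(** The zeros chain up: h^(1) supplies V^(1) and -V^(N+1), and nu^(k) supplies V^(k+1) and -V^(k)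
    for k <= N. Together these are V^(k) and -V^(k) for 1 <= k <= N + 1, the zeros of [den]. *)
Let num := cm 1 h * \prod_(1 <= k < N.+1) cm k nu0.
Let den := \prod_(1 <= k < N.+2) (T - C (x_ k)).

Lemma num_eval x y : on_curve EL x y -> coord_eval x y num
  = coord_eval x y (cm 1 h) * \prod_(1 <= k < N.+1) coord_eval x y (cm k nu0).
Proof. by move=> xy; rewrite coord_evalM // coord_eval_prod. Qed.

Lemma den_eval x y : on_curve EL x y ->
  coord_eval x y den = \prod_(1 <= k < N.+2) (x - x_ k).
Proof.
move=> xy; rewrite coord_eval_prod //; apply: eq_bigr => k _.
by rewrite coord_evalB coord_evalT coord_evalC.
Qed.

Lemma num_V k : (1 <= k < N.+2)%N -> coord_eval (x_ k) (y_ k) num = 0.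
Proof.
have [_ nuV1 _ _] := nu0_geometry.
case: k => [//|[|k]] kN; rewrite num_eval; try exact: x_on_curve.
  by rewrite (cm_eval0 1 hV0) mul0r.
rewrite (prod_seq_eq0 (k := k.+1)) ?mulr0 // ?mem_index_iota //.
by have := cm_eval0 k.+1 nuV1; rewrite !frob_frob addn1.
Qed.

Lemma num_oppV k : (1 <= k < N.+2)%N -> coord_eval (x_ k) (yo k) num = 0.
Proof.
have [_ _ nuV _] := nu0_geometry.
move=> /andP[k1 kN]; rewrite num_eval; last exact/on_curve_opp/x_on_curve.
have [kE|kN'] := eqVneq k N.+1.
  by have := cm_eval0 1 hVN; rewrite frob_oppV frob_frob add1n -kE => ->; rewrite mul0r.
rewrite (prod_seq_eq0 (k := k)) ?mulr0 //; first by rewrite mem_index_iota k1; lia.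
(* [expr1] presents alpha and beta as their own 0-th twists, so that [frob_oppV] applies. *)
have := cm_eval0 k nuV; rewrite -[X in coord_eval _ (frob q k (- X - _ - _))]expr1.
rewrite -[X in coord_eval _ (frob q k (_ - _ * X - _))]expr1.
by rewrite (frob_oppV k 0) addn0.
Qed.

(** The alpha^(k) are distinct by degree, and V^(k) != -V^(k) because V, having degrees (2, 3), is
    not 2-torsion. *)
Lemma interpolant_exists : exists H, num = H * den.
Proof.
have [||H ->] := @coord_dvd_prod L EL [seq x_ k | k <- index_iota 1 N.+2] num.
- rewrite map_inj_in_uniq ?iota_uniq // => k l _ _ xkl.
  by apply/eqP; apply: contraTT isT => /x_neq; rewrite xkl eqxx.
- move=> x /mapP[k]; rewrite mem_index_iota => kN ->.
  exists (y_ k), (yo k); rewrite num_V // num_oppV //; split=> //.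
  have : 2 * y_ k + wa1 EL * x_ k + wa3 EL != 0.
    have := not_two_torsion hK hE (proj1 V_degrees) (proj2 V_degrees).
    rewrite -(fmorph_eq0 (fr k)) rmorphD rmorphD rmorphM rmorphM rmorph_nat.
    have -> : fr k (wa1 EL) = wa1 EL := congr1 (@wa1 L) (frob_curve iota k).
    by have -> : fr k (wa3 EL) = wa3 EL := congr1 (@wa3 L) (frob_curve iota k).
  apply: contra_neq => e; rewrite mulr2n mulrDl !mul1r {2}e; ring.
by exists H; rewrite big_map.
Qed.

Variable H : coordring EL.
Hypothesis numE : num = H * den.

(* V = - Xi may occur, in which case den vanishes at Xi^(k); multiplying by the
   conjugate of nu^(k) removes the factor t - alpha^(k). *)
Lemma interpolant_Xi k : (1 <= k < N.+1)%N ->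
  coord_eval (frob q k theta) (frob q k eta) H = 0.
Proof.
move=> kN; have onXi : on_curve EL (frob q k theta) (frob q k eta).
  exact: (on_curve_map (frob_curve iota k) (on_curve_Xi iota)).
pose den' := \prod_(1 <= l < N.+2 | l != k) (T - C (x_ l)).
pose num' := cm 1 h * \prod_(1 <= l < N.+1 | l != k) cm l nu0.
have denE : den = (T - C (x_ k)) * den'.
  by rewrite /den (bigD1_seq k) ?iota_uniq // mem_index_iota; lia.
have numE' : num = cm k nu0 * num'.
  rewrite /num (bigD1_seq k) ?iota_uniq ?mem_index_iota //=; rewrite /num'; ring.
have [_ _ _ nuC] := nu0_geometry.
have cnu : cm k (coord_conj nu0) * cm k nu0
    = - ((T - C (frob q k theta)) * (T - C (x_ k)) * (T - C (x_ k.+1))).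
  rewrite -cmM nuC -[- _]mulN1r !cmM !cm_TsubC frob_frob addn1.
  have -> : cm k (-1) = -1 :> coordring EL.
    apply: coord_eqP; first by have := rmorphN1 (map_poly (fr k)).
    rewrite -[LHS]/(map_poly (fr k) (- 0)) -[RHS]/(- 0 : {poly L}) oppr0.
    exact: rmorph0.
  by rewrite mulN1r.
have : (T - C (x_ k)) * (cm k (coord_conj nu0) * H * den')
    = (T - C (x_ k)) * (- ((T - C (frob q k theta)) * (T - C (x_ k.+1)) * num')).
  transitivity (cm k (coord_conj nu0) * (H * den)); first by rewrite denE; ring.
  by rewrite -numE numE' mulrA cnu; ring.
move/(mulfI (monic_neq0 (proj2 (deg_sgn_TsubC _ _)))).
move/(congr1 (coord_eval (frob q k theta) (frob q k eta))).
rewrite -mulN1r !coord_evalM // [coord_eval _ _ (T - C (frob q k theta))]coord_evalB.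
rewrite coord_evalT coord_evalC subrr !(mul0r, mulr0) => /eqP.
(* The factors other than H are nonzero at Xi^(k): the conjugate because Xi is not 2-torsion, [den']
   because it only involves alpha^(l) with l != k. *)
rewrite !mulf_eq0 => /orP[/orP[|/eqP //]|].
  rewrite frob_eval (fmorph_eq0 (fr k)) /nu0 conj_line_Xi oppr_eq0.
  by rewrite (negbTE (not_two_torsion hK hE (isdeg_theta hK) (isdeg_eta hK))).
rewrite coord_eval_prod // prodf_seq_eq0 => /hasP[l _ /andP[lk]].
rewrite coord_evalB coord_evalT coord_evalC subr_eq0.
by rewrite (negbTE (isdeg2_neq (theta_deg k) (x_deg l) _)) // eq_sym.
Qed.

Lemma den_monic : coord_deg den = N.+1.*2 /\ coord_sgn den = 1.
Proof.
have [-> ->] := coord_monic_prod (index_iota 1 N.+2) (fun k => deg_sgn_TsubC EL (x_ k)).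
by rewrite size_iota subn1 mul2n.
Qed.

(** Degree count: (n + 2 - N) + 3 N for [num], minus 2 (N + 1) for [den], is n. *)
Lemma interpolant_monic n : coord_deg h = (n + 2 - N)%N -> (N <= n)%N ->
  coord_sgn h = 1 -> coord_deg H = n /\ coord_sgn H = 1.
Proof.
move=> hd Nn hs; have [dd ds] := den_monic.
have [pd ps] := coord_monic_prod (index_iota 1 N.+1) cm_nu0_monic.
have ns : coord_sgn num = 1.
  by rewrite coord_sgnM ps mulr1 (coord_sgn_map (fr 1)) hs rmorph1.
have nd : coord_deg num = (n + 2 - N + 3 * N)%N.
  rewrite coord_degM ?monic_neq0 //; last by rewrite (coord_sgn_map (fr 1)) hs rmorph1.
  by rewrite pd size_iota subn1 (coord_deg_map (fr 1)) hd.
have Hs : coord_sgn H = 1 by move: ns; rewrite numE coord_sgnM ds mulr1.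
split=> //; move: nd; rewrite numE coord_degM ?monic_neq0 // dd.
by move: (coord_deg H) => d; lia.
Qed.

(** P is fixed by Frobenius, so h^(1) still vanishes there, whereas [den] does not: nonzero
    constants have degree 0 and every alpha^(k) has positive degree. *)
Lemma interpolant_const t0 y0 : on_curve E t0 y0 ->
  coord_eval (kp t0) (kp y0) h = 0 -> coord_eval (kp t0) (kp y0) H = 0.
Proof.
move=> ty hP; have onP := on_curve_kappa iota ty.
have := congr1 (coord_eval (kp t0) (kp y0)) numE.
have := cm_eval0 1 hP; rewrite (frob_const kp) (frob_const kp) => h1.
rewrite num_eval // h1 mul0r coord_evalM // => /esym/eqP.
rewrite mulf_eq0 => /orP[/eqP //|].
rewrite den_eval // prodf_seq_eq0 => /hasP[l _] /=.
by rewrite subr_eq0 (negbTE (kappa_neq_x _ _)).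
Qed.

End Interpolant.

(** Both formulas at once, with i = n + 2: [b] false gives N = i - 1 and deg h = 3, [b] true gives N
    = i - 2 and deg h = 4, the extra zero of h being P. *)
Lemma shtuka_value t0 y0 (b : bool) n (h : coordring EL) : on_curve E t0 y0 ->
  let N := (n + ~~ b)%N in
  coord_deg h = (3 + b)%N -> coord_sgn h = 1 ->
  coord_eval al be h = 0 -> coord_eval (x_ N) (yo N) h = 0 ->
  (b -> coord_eval (kp t0) (kp y0) h = 0) ->
  has_value (twist q N.+1 (shtuka_nu iota al be)
             / (twist q 1 (h%:F : funfield EL)
                * \prod_(1 <= k < N.+2) twist q k (shtuka_f iota al be)))
    theta eta (iota (recip_sum (monic_vanishing t0 y0 b n.+2))).
Proof.
move=> ty N hd hs hV0 hVN hP.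
have [H numE] := interpolant_exists hV0 hVN.
set num := cm 1 h * _ in numE; set den := \prod_(1 <= k < N.+2) _ in numE.
have [Hd Hs] : coord_deg H = n.+2 /\ coord_sgn H = 1.
  apply: (interpolant_monic numE) hs; last by rewrite /N; case: (b); lia.
  by rewrite hd /N; case: (b); lia.
have [Hn H1] : deg_le n.+2 H /\ deg_coef n.+2 H = 1 by apply/coord_deg_sgn.
have HP : b -> coord_eval (kp t0) (kp y0) H = 0.
  by move=> bT; apply: (interpolant_const numE ty); apply: hP.
have HXi k : (k < N)%N -> coord_eval (frob q k.+1 theta) (frob q k.+1 eta) H = 0.
  by move=> kN; apply: (interpolant_Xi numE).
have [HXi0 ->] := recip_sum_interpolation ty Hn H1 HP HXi.
have onXi := on_curve_Xi iota.
have den0 : coord_eval theta eta den != 0.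
  rewrite den_eval // prodf_seq_eq0; apply/hasPn => -[|l]; rewrite mem_index_iota //.
  by move=> _ /=; rewrite subr_eq0 theta_neq_x.
(* The value is den / num = 1 / H at Xi, and num(Xi) = H(Xi) den(Xi) is nonzero. *)
exists den, num; rewrite numE coord_evalM // mulf_neq0 //; split=> //; last first.
  by rewrite invfM mulrCA divff // mulr1.
rewrite -numE shtuka_nuE !twist_tofrac.
under [X in _ / (_ * X)]eq_bigr => k _ do rewrite twist_f.
rewrite prodf_div -!(rmorph_prod (@FracField.tofrac (coordring EL))) /=.
rewrite big_nat_recr //= /num !tofracM.
have nz (g : coordring EL) : coord_sgn g = 1 -> g%:F != 0 :> funfield EL.
  by move=> g1; rewrite tofrac_eq0 monic_neq0.
have d0 := nz _ (proj2 (den_monic N)); rewrite -/den in d0 *.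
have h0 : (cm 1 h)%:F != 0 :> funfield EL.
  by apply: nz; rewrite (coord_sgn_map (fr 1)) hs rmorph1.
have n0 := nz _ (proj2 (cm_nu0_monic N.+1)).
have p0 := nz _ (proj2 (coord_monic_prod (index_iota 1 N.+1) cm_nu0_monic)).
by rewrite (div_cancel n0 d0 h0 p0).
Qed.

End Shtuka.

(** * From divisors to regular functions and their zeros *)

Section RegularDivisor.
Variables (L : fieldType) (E : wcurve L).
Local Notation R := (coordring E).
Local Notation PI := (@points_ideal L E).

Lemma points_ideal_Inf k : PI (nseq k Inf) 1.
Proof.
elim: k => [//|k IH] /=; exists [:: (1, 1)]; rewrite big_seq1 mulr1; split=> //.
by move=> p; rewrite inE => /eqP ->.
Qed.

Lemma points_ideal_eval zs x y (h : R) : on_curve E x y ->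
  List.In (Aff x y) zs -> PI zs h -> coord_eval x y h = 0.
Proof.
move=> xy; elim: zs h => [//|Q zs IH] h Qzs [s [sP ->]].
have {Qzs} sP0 p : p \in s -> coord_eval x y (p.1 * p.2) = 0.
  move=> /sP[p1 p2]; rewrite coord_evalM //.
  case: Qzs => [QE|zsV]; last by rewrite (IH _ zsV p2) mulr0.
  by move: p1; rewrite QE /= => ->; rewrite mul0r.
elim: s {sP} sP0 => [|p s IHs] sP0.
  by rewrite big_nil; exact: (coord_evalC E x y 0).
rewrite big_cons coord_evalD sP0 ?mem_head // add0r IHs // => p' p's.
by apply: sP0; rewrite inE p's orbT.
Qed.

(** With all poles at infinity the ideal of the poles contains 1, so g itself lies in the ideal of
    the zeros. The degree keeps the term [mult_infty zs], since a zero obtained by the group law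
    might be infinity. *)
Lemma regular_of_divisor (g : funfield E) zs k :
  frac_sgn g = 1 -> has_divisor g zs (nseq k Inf) ->
  exists h : R, [/\ g = h%:F, PI zs h, coord_sgn h = 1 &
    (coord_deg h)%:Z = k%:Z - (mult_infty zs)%:Z].
Proof.
move=> g1 [g0 gE gdeg].
have [h hzs hg] : [set h%:F | h in PI zs] g.
  by rewrite -gE; exists 1; [exact: points_ideal_Inf | rewrite tofrac1 mulr1].
exists h; have h0 : h != 0 by rewrite -tofrac_eq0 hg.
have c1 : coord_deg (1 : R) = 0%N.
  by rewrite /coord_deg /= eqxx maxn0 size_polyC oner_neq0.
split=> //.
  have := frac_sgnE h (oner_neq0 R); rewrite tofrac1 divr1 hg g1.
  by rewrite (coord_sgnC E 1 : coord_sgn (1 : R) = 1) divr1.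
have := frac_degE h0 (oner_neq0 R); rewrite tofrac1 divr1 hg c1 subr0 => <-.
move: gdeg; rewrite (_ : mult_infty (nseq k Inf) = k); last first.
  by rewrite /mult_infty count_nseq mul1n.
by move: (frac_deg g) (mult_infty zs) => d m; clear; lia.
Qed.

Lemma ec_sub_affine x1 y1 x2 y2 : x1 != x2 ->
  exists x y, ec_sub E (Aff x1 y1) (Aff x2 y2) = Aff x y.
Proof. by move=> x12; rewrite /ec_sub /= (negbTE x12) /=; do 2 eexists. Qed.

Lemma ec_sub_Inf x1 y1 x2 y2 :
  ec_sub E (Aff x1 y1) (Aff x2 y2) = Inf -> Aff x1 y1 = Aff x2 y2.
Proof.
rewrite /ec_sub /=; case: ifP => // /andP[/eqP -> /eqP e] _.
by congr Aff; apply/eqP; rewrite -subr_eq0 -e; apply/eqP; ring.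
Qed.

Lemma ec_subrr x y : ec_sub E (Aff x y) (Aff x y) = Inf.
Proof. by rewrite /ec_sub /= eqxx ifT //=; apply/eqP; ring. Qed.

End RegularDivisor.

Section ShtukaDivisors.
Variables (F : finFieldType) (E : wcurve F) (hE : elliptic E).
Variables (L : fieldType) (iota : {rmorphism funfield E -> L}) (deg : L -> int).
Hypothesis hK : is_completion iota (@frac_deg F E) deg.
Local Notation q := #|F|.
Local Notation EL := (curve_ext iota).
Local Notation kp := (kappa iota).
Variables (al be : L).
Hypothesis hV : in_formal_group deg EL al be.
Hypothesis hXi : ec_sub EL (Aff al be) (ec_frob q 1 (Aff al be))
                 = Aff (thetaK iota) (etaK iota).

(* If V^(n) - V were the constant point P, then -P would lie on the line through
   V^(n) and -V, whose slope has degree q^n, too large for P and V. *)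
Lemma sub_const_affine n (t0 y0 : F) :
  exists x y, ec_sub EL (ec_sub EL (ec_frob q n (Aff al be)) (Aff al be))
                (Aff (kp t0) (kp y0)) = Aff x y.
Proof.
case: n => [|n].
  (* This case occurs for i = 2: V - V is infinity and the point is simply -P. *)
  rewrite (_ : ec_frob q 0 (Aff al be) = Aff al be) ?ec_subrr; last first.
    by rewrite /ec_frob /= /frob !expr1.
  by do 2 eexists.
have xn : frob q n.+1 al != al by rewrite eq_sym; exact: (al_neq_x hK hV hXi).
have [Q1 [Q2 QE]] := ec_sub_affine EL (frob q n.+1 be) be xn.
rewrite -[ec_frob _ _ _]/(Aff (frob q n.+1 al) (frob q n.+1 be)) QE.
case QP : (ec_sub _ _ _) => [|x y]; last by exists x, y.
move: QE; rewrite (ec_sub_Inf QP) /ec_sub /= (negbTE xn) /=.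
set s := (_ / (al - _)) => -[-> PE].
have [ad bd] := V_degrees hK hV hXi.
have xd := x_deg hK hV hXi n.+1; have yd := y_deg hK hV hXi n.+1.
have kle := degle_kappa hK; set Q := (q ^ n.+1)%:Z in xd yd.
have Q2' : 2 <= Q.
  have := finNzRing_gt1 F; rewrite /Q expnS lez_nat => q1.
  have : (0 < q ^ n)%N by rewrite expn_gt0 ltnW.
  by move: q1; clear; move: (q) (q ^ n)%N => a b; nia.
set x := frob q n.+1 al in xn xd s PE; set y := frob q n.+1 be in yd s PE.
set yV := - be - wa1 EL * al - wa3 EL in s PE.
have yVd : isdeg deg yV 3.
  apply: (isdegB hK); last by apply: degleW (kle _).
  apply: (isdegB hK); first exact: (isdegN hK).
  by rewrite -[3 - 1]add0r; apply: (degleM hK) (kle _) (isdeg_degle ad).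
have sE : s * (al - x) = yV - y by rewrite /s divfK // subr_eq0 eq_sym.
have numd : isdeg deg (yV - y) (3 * Q).
  by apply: (isdegBr hK) => //; apply: degleW (isdeg_degle yVd); move: Q2'; clear; lia.
have dend : isdeg deg (al - x) (2 * Q).
  by apply: (isdegBr hK) => //; apply: degleW (isdeg_degle ad); move: Q2'; clear; lia.
have s0 : s != 0.
  by apply: contraTneq (proj1 numd) => s0; rewrite -sE s0 mul0r eqxx.
have sd : isdeg deg s Q.
  split=> //; have := isdegM hK (conj s0 erefl) dend; rewrite sE => /(isdeg_inj numd).
  by clear; lia.
have lined : isdeg deg (s * (al - kp t0)) (Q + 2).
  by apply: (isdegM hK) => //; apply: (isdegB hK) => //; apply: degleW (kle _).
have : degle deg (s * (al - kp t0)) 3.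
  have -> : s * (al - kp t0) = kp y0 + wa1 EL * kp t0 + wa3 EL + yV.
    have -> : yV = s * (al - x) + y by rewrite sE subrK.
    by rewrite (esym PE : kp y0 = _); ring.
  apply: (degleD hK); last exact: isdeg_degle yVd.
  apply: (degleW (m := 0)) => //; apply: (degleD hK); last exact: kle.
  by apply: (degleD hK); [exact: kle | rewrite -[0]addr0; apply: (degleM hK); exact: kle].
by move=> /(isdeg_le lined); move: Q2'; clear; lia.
Qed.

End ShtukaDivisors.

Theorem theorem6p5
  (F : finFieldType) (E : wcurve F) (hE : elliptic E)
  (Kinf : fieldType) (iota : {rmorphism funfield E -> Kinf}) (deg : Kinf -> int)
  (hK : is_completion iota (@frac_deg F E) deg)
  (alpha beta : Kinf)
  (hV : in_formal_group deg (curve_ext iota) alpha beta)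
  (hXi : ec_sub (curve_ext iota) (Aff alpha beta) (ec_frob #|F| 1 (Aff alpha beta))
         = Aff (thetaK iota) (etaK iota))
  (t0 y0 : F) (hP : on_curve E t0 y0) :
  let q := #|F| in
  let V := Aff alpha beta in
  let P := map_point (const_emb iota) (Aff t0 y0) in
  let opp := ec_opp (curve_ext iota) in
  let sub := ec_sub (curve_ext iota) in
  let nu := shtuka_nu iota alpha beta in
  let f := shtuka_f iota alpha beta in
  (forall (i : nat) (g : funfield (curve_ext iota)), (2 <= i)%N ->
     frac_sgn g = 1 ->
     has_divisor g
       [:: sub (ec_frob q i.-1 V) V; opp (ec_frob q i.-1 V); V]
       [:: Inf; Inf; Inf] ->
     has_value (twist q i nu
                / (twist q 1 g * \prod_(1 <= k < i.+1) twist q k f))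
       (thetaK iota) (etaK iota) (iota (recip_sum (A_monic E i))))
  /\
  (forall (i : nat) (g : funfield (curve_ext iota)), (2 <= i)%N ->
     frac_sgn g = 1 ->
     has_divisor g
       [:: sub (sub (ec_frob q i.-2 V) V) P; opp (ec_frob q i.-2 V); V; P]
       [:: Inf; Inf; Inf; Inf] ->
     has_value (twist q i.-1 nu
                / (twist q 1 g * \prod_(1 <= k < i) twist q k f))
       (thetaK iota) (etaK iota)
       (iota (recip_sum (A_monic E i `&` prime_of E t0 y0)))).
Proof.
move=> q V P opp sub nu f.
have onV := V_on_curve hV.
have onV' k := x_on_curve hV k.
split=> [|] [|[|n]] // g _ g1 div_g.
- have [h [gE hzs hs hd]] := regular_of_divisor (k := 3) g1 div_g.
  (* Since i - 1 >= 1, the points V^(i-1) and V have different first coordinates; their difference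
     is affine, no zero cancels a pole, and h has degree exactly 3. *)
  have xn : frob q n.+1 alpha != alpha by rewrite eq_sym; exact: (al_neq_x hK hV hXi).
  have [Q1 [Q2 QE]] := ec_sub_affine (curve_ext iota) (frob q n.+1 beta) beta xn.
  have -> : A_monic E n.+2 = monic_vanishing t0 y0 false n.+2.
    by apply/seteqP; split=> a /= => [[]|[]].
  have {hd} hd : coord_deg h = 3%N.
    move: hd; rewrite (QE : sub (ec_frob q n.+2.-1 V) V = _) /mult_infty /= subr0.
    by case.
  have := @shtuka_value F E hE Kinf iota deg hK alpha beta hV hXi t0 y0 false n h hP.
  rewrite /= addn1 gE; apply=> //.
  + by apply: points_ideal_eval hzs => //=; do 2 right; left.
  + apply: points_ideal_eval hzs; first exact: on_curve_opp (onV' n.+1).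
    by right; left.
- have [h [gE hzs hs hd]] := regular_of_divisor (k := 4) g1 div_g.
  have [Q1 [Q2 QE]] := sub_const_affine hK hV hXi n t0 y0.
  have -> : A_monic E n.+2 `&` prime_of E t0 y0 = monic_vanishing t0 y0 true n.+2.
    apply/seteqP; split=> a /= [am].
      by move=> /(prime_of_eval hP) aP; split.
    by move=> /(_ isT) aP; split=> //; apply/(prime_of_eval hP).
  have {hd} hd : coord_deg h = 4%N.
    move: hd; rewrite (QE : sub (sub (ec_frob q n.+2.-2 V) V) P = _) /mult_infty /= subr0.
    by case.
  have := @shtuka_value F E hE Kinf iota deg hK alpha beta hV hXi t0 y0 true n h hP.
  rewrite /= addn0 gE; apply=> //.
  + by apply: points_ideal_eval hzs => //=; do 2 right; left.
  + apply: points_ideal_eval hzs; first exact: on_curve_opp (onV' n).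
    by right; left.
  + move=> _; apply: points_ideal_eval hzs; first exact: on_curve_kappa hP.
    by do 3 right; left.
Qed.
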